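(* Let $\mu$ be a strongly irreducible and proximal Borel probability measure on $GL_d(\mathbb{R})$, $d\ge 2$. Assume that for some $r\in(0,1)$ and some $\delta>0$, $$\int_{GL_d(\mathbb{R})} e^{\delta(\log N(g))^r}\,\mu(dg)<\infty .$$ Then there exists a positive constant $C$ such that, for any $y>0$, $$\limsup_{n\to\infty}\frac1{n^r}\log\ \sup_{\|x\|=1}\mathbb{P}\Big(\max_{1\le k\le n}\big|\log\|A_kx\|-k\lambda_\mu\big|>ny\Big)\le -C\,y^r.$$
   Context: $(Y_n)_{n\ge1}$ are independent identically distributed random variables on a probability space $(\Omega,\mathcal F,\mathbb P)$ with values in $GL_d(\mathbb{R})$ and common law $\mu$; $A_0=\mathrm{Id}$ and $A_k=Y_k\cdots Y_1$ for $k\ge1$. $\|\cdot\|$ is the Euclidean norm on $\mathbb{R}^d$, $\|g\|=\sup_{\|x\|=1}\|gx\|$ for $g\in GL_d(\mathbb{R})$, and $N(g)=\max(\|g\|,\|g^{-1}\|)$. Suprema over $\|x\|=1$ are over $x\in\mathbb{R}^d$. $\Gamma_\mu$ denotes the closed semigroup generated by the support of $\mu$. $\mu$ is strongly irreducible if no finite union of proper nonzero subspaces of $\mathbb{R}^d$ is invariant under $\Gamma_\mu$. $\mu$ is proximal if $\Gamma_\mu$ contains a matrix admitting a unique (with multiplicity one) eigenvalue of maximum modulus. Under these assumptions there is a unique $\mu$-invariant probability measure $\nu$ on the projective space $X=P_{d-1}(\mathbb{R})$, i.e. $\int_X h(u)\,\nu(du)=\int\int_X h(g\cdot u)\,\mu(dg)\nu(du)$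 for all bounded Borel $h:X\to\mathbb{R}$. For $g\in GL_d(\mathbb{R})$ and $x\in\mathbb{R}^d\setminus\{0\}$ with class $\bar x\in X$, let $\sigma(g,\bar x)=\log(\|gx\|/\|x\|)$. When $\int\log N\,d\mu<\infty$, set $\lambda_\mu=\int\int_X\sigma(g,u)\,\mu(dg)\nu(du)$. Convention: $\log 0=-\infty$. *)

(* Defs.v *)
From HB Require Import structures.
From mathcomp Require Import all_boot all_order all_algebra generic_quotient.
From mathcomp Require Import complex.
From mathcomp Require Import all_classical all_reals all_analysis.

Set Implicit Arguments.
Unset Strict Implicit.
Unset Printing Implicit Defensive.

Import Order.TTheory GRing.Theory Num.Theory.
Import numFieldNormedType.Exports.

Local Open Scope classical_set_scope.
Local Open Scope ring_scope.

Section euclidean_norm.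
Variables (R : realType) (d : nat).

Definition enorm (x : 'cV[R]_d) : R := Num.sqrt (\sum_i x i 0 ^+ 2).

Definition usphere : set 'cV[R]_d := [set x | enorm x = 1].

Definition opnorm (g : 'M[R]_d) : R := sup [set enorm (g *m x) | x in usphere].

Lemma enorm0 : enorm 0 = 0.
Proof. by rewrite /enorm big1 ?sqrtr0// => i _; rewrite mxE expr0n. Qed.

Lemma enormZ c x : enorm (c *: x) = `|c| * enorm x.
Proof.
rewrite /enorm -[`|c|]sqrtr_sqr -sqrtrM ?sqr_ge0//; congr Num.sqrt.
by rewrite mulr_sumr; apply: eq_bigr => i _; rewrite mxE exprMn.
Qed.

End euclidean_norm.

(* GL_d(R), with the topology induced by that of the matrices and the
   corresponding Borel sigma-algebra. *)
Record GL (R : realType) (d : nat) :=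
  MkGL { GLmx :> 'M[R]_d ; GLmx_unit : GLmx \in unitmx }.

Section GL_structures.
Variables (R : realType) (d : nat).

HB.instance Definition _ := [isSub for @GLmx R d].
HB.instance Definition _ := [Choice of GL R d by <:].
HB.instance Definition _ :=
  Topological.copy (GL R d) (initial_topology (@GLmx R d)).

Definition GL1 : GL R d := MkGL (unitmx1 R d).

Definition GLmul (g h : GL R d) : GL R d :=
  @MkGL R d (g *m h)
    (etrans (unitmx_mul g h) (introT andP (conj (GLmx_unit g) (GLmx_unit h)))).

HB.instance Definition _ := isPointed.Build (GL R d) GL1.
HB.instance Definition _ :=
  Measurable.copy (GL R d) (g_sigma_algebraType (@open (GL R d))).

Definition GL_N (g : GL R d) : R :=
  Num.max (opnorm g) (opnorm (invmx g)).

End GL_structures.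

(* Projective space P_n(R): the quotient of R^(n+1) \ {0} by the relation
   "equal up to a nonzero scalar", with the quotient topology and the
   corresponding Borel sigma-algebra. *)
Record nzvec (R : realType) (n : nat) :=
  MkNzvec { nzvec_val :> 'cV[R]_n.+1 ; nzvec_neq0 : nzvec_val != 0 }.

Section projective_space.
Variables (R : realType) (n : nat).

HB.instance Definition _ := [isSub for @nzvec_val R n].
HB.instance Definition _ := [Choice of nzvec R n by <:].
HB.instance Definition _ :=
  Topological.copy (nzvec R n) (initial_topology (@nzvec_val R n)).

Fact nzvec_point_subproof : const_mx 1 != 0 :> 'cV[R]_n.+1.
Proof. by apply/eqP => /matrixP/(_ 0 0)/eqP; rewrite !mxE oner_eq0. Qed.

HB.instance Definition _ :=
  isPointed.Build (nzvec R n) (MkNzvec nzvec_point_subproof).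

Definition collinear (x y : nzvec R n) : bool :=
  `[< exists2 c : R, c != 0 & nzvec_val y = c *: nzvec_val x >].

Fact collinear_refl : reflexive collinear.
Proof. by move=> x; apply/asboolP; exists 1; rewrite ?oner_eq0 ?scale1r. Qed.

Fact collinear_sym : symmetric collinear.
Proof.
suff s x y : collinear x y -> collinear y x by move=> x y; apply/idP/idP; exact: s.
move=> /asboolP[c c0 yE]; apply/asboolP; exists c^-1; first by rewrite invr_eq0.
by rewrite yE scalerA mulVf// scale1r.
Qed.

Fact collinear_trans : transitive collinear.
Proof.
move=> y x z /asboolP[a a0 yE] /asboolP[b b0 zE]; apply/asboolP.
by exists (b * a); rewrite ?mulf_neq0// zE yE scalerA.
Qed.

Canonical collinear_equiv :=
  EquivRel collinear collinear_refl collinear_sym collinear_trans.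

Definition projspace := {eq_quot collinear_equiv}%qT.

HB.instance Definition _ :=
  Topological.copy projspace (quotient_topology projspace).
HB.instance Definition _ := Quotient.on projspace.
HB.instance Definition _ :=
  isPointed.Build projspace (\pi_projspace%qT (point : nzvec R n)).
HB.instance Definition _ :=
  Measurable.copy projspace (g_sigma_algebraType (@open projspace)).

Fact nzvec_act_subproof (g : GL R n.+1) (x : nzvec R n) :
  GLmx g *m nzvec_val x != 0.
Proof.
apply: contra (nzvec_neq0 x) => /eqP gx0.
by rewrite -(mulKmx (GLmx_unit g) (nzvec_val x)) gx0 mulmx0.
Qed.

Definition nzvec_act (g : GL R n.+1) (x : nzvec R n) : nzvec R n :=
  MkNzvec (nzvec_act_subproof g x).

Definition proj_act (g : GL R n.+1) (u : projspace) : projspace :=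
  \pi_projspace%qT (nzvec_act g (repr u)).

Definition sigma_cocycle (g : GL R n.+1) (u : projspace) : R :=
  let x : 'cV[R]_n.+1 := nzvec_val (repr u) in ln (enorm (g *m x) / enorm x).

(* [proj_act] and [sigma_cocycle] do not depend on the choice of [repr u]. *)
Lemma repr_piP (x : nzvec R n) :
  exists2 c : R, c != 0 &
    nzvec_val (repr (\pi_projspace%qT x)) = c *: nzvec_val x.
Proof.
by apply/asboolP; have /eqquotP := esym (reprK (\pi_projspace%qT x)).
Qed.

Lemma proj_act_pi g x :
  proj_act g (\pi_projspace%qT x) = \pi_projspace%qT (nzvec_act g x).
Proof.
have [c c0 E] := repr_piP x; rewrite /proj_act; apply/eqP; rewrite eq_sym.
by apply/eqP/eqquotP/asboolP; exists c => //=; rewrite E scalemxAr.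
Qed.

Lemma sigma_cocycle_pi g x :
  sigma_cocycle g (\pi_projspace%qT x) = ln (enorm (g *m x) / enorm x).
Proof.
have [c c0 E] := repr_piP x; rewrite /sigma_cocycle /= E -scalemxAr !enormZ.
by rewrite invfM mulrACA divff ?normr_eq0// mul1r.
Qed.

End projective_space.

Section random_matrix_law.
Variable R : realType.

Definition law_support d (mu : probability (GL R d) R) : set (GL R d) :=
  [set g | forall U : set (GL R d), open U -> U g -> (0 < mu U)%E].

Definition Gamma d (mu : probability (GL R d) R) : set (GL R d) :=
  smallest [set S : set (GL R d) |
      closed S /\ (forall g h, S g -> S h -> S (GLmul g h))]
    (law_support mu).

(* The union is over a nonempty family: the empty union is trivially
   invariant. *)
Definition strongly_irreducible d (mu : probability (GL R d) R) : Prop :=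
  ~ exists s : seq {vspace 'cV[R]_d},
      [/\ s != [::],
          (forall V, V \in s -> V != 0%VS /\ V != fullv) &
          forall (g : GL R d), Gamma mu g ->
          forall x : 'cV[R]_d, (exists2 V, V \in s & x \in V) ->
          exists2 V, V \in s & g *m x \in V].

Definition proximal_mx d (g : 'M[R]_d) : Prop :=
  let gC : 'M[R[i]]_d := map_mx (real_complex R) g in
  exists z : R[i],
    [/\ eigenvalue gC z, mup z (char_poly gC) = 1%N &
        forall w : R[i], eigenvalue gC w -> w != z -> `|w| < `|z|].

Definition proximal d (mu : probability (GL R d) R) : Prop :=
  exists2 g : GL R d, Gamma mu g & proximal_mx g.

Definition invariant_measure n (mu : probability (GL R n.+1) R)
    (nu : probability (projspace R n) R) : Prop :=
  forall h : projspace R n -> R, measurable_fun setT h ->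
    (exists M, forall u, `|h u| <= M) ->
    \int[nu]_u h u = \int[(mu \x nu)%E]_z h (proj_act z.1 z.2).

Definition lyapunov n (mu : probability (GL R n.+1) R)
    (nu : probability (projspace R n) R) : R :=
  \int[(mu \x nu)%E]_z sigma_cocycle z.1 z.2.

End random_matrix_law.

Section random_products.
Context {R : realType} {disp : measure_display} {T : measurableType disp}
  {P : probability T R}.

Definition mutually_independent disp' (T' : measurableType disp')
    (Y : nat -> {RV P >-> T'}) : Prop :=
  forall (s : seq nat) (B : nat -> set T'),
    uniq s -> (forall i, measurable (B i)) ->
    P (\big[setI/setT]_(i <- s) (Y i @^-1` B i)) =
    (\prod_(i <- s) P (Y i @^-1` B i))%E.

Definition iid_with_law disp' (T' : measurableType disp')
    (mu : probability T' R) (Y : nat -> {RV P >-> T'}) : Prop :=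
  mutually_independent Y /\
  forall i (B : set T'), measurable B -> distribution P (Y i) B = mu B.

(* [Y] is numbered from 0: [Y k] is the (k+1)-st factor. *)
Fixpoint rprod d (Y : nat -> {RV P >-> GL R d}) (k : nat) (w : T) : GL R d :=
  if k is k'.+1 then GLmul (Y k' w) (rprod Y k' w) else @GL1 R d.

Definition max_deviation d (Y : nat -> {RV P >-> GL R d}) (lambda : R)
    (x : 'cV[R]_d) (n : nat) (w : T) : R :=
  \big[Num.max/0]_(1 <= k < n.+1)
    `|ln (enorm (rprod Y k w *m x)) - k%:R * lambda|.

End random_products.

(* Main.v *)
(* Let D_m(x) be the mean of log(|A_m x| / |x|).
   If eta D_m(x) <= m (b + y / 4) for all x, with eta = 1 or -1, then cutting
   the first j <= N factors into blocks of length m, truncating each block at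
   scale N y and applying Markov's inequality to exp(s eta log|A_j x|), with
   s = (c / 2) (N y)^(r - 1), yields
     P(eta log|A_j x| > N y + j b) <= exp(- (c / 3) (N y)^r),
   with a rate independent of m. It remains to show that D_m / m is close to
   lambda_mu, uniformly in x, for some m.
   Let beta be the supremum of the b such that D_m >= m b everywhere for some
   m. The bound above with eta = -1 makes growth below beta per step very
   unlikely, so a direction x with D_i(x) close to i beta has log|A_i x| below
   i (beta + w) with probability close to 1. By irreducibility, whenever
   |A_i z| is large for another direction z, |A_i h x| is comparably large for
   the product h of a bounded number of earlier factors, with a probability
   bounded below. Hence |A_i z| is rarely large and D_i(z) <= i (beta + w) for
   every z. Integrating D_m against the invariant measure gives m lambda_mu, so
   lambda_mu = beta. *)
From HB Require Import structures.
Require Import Defs.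
From mathcomp Require Import all_boot all_order all_algebra.
From mathcomp Require Import ring lra.
From mathcomp Require Import all_classical all_reals all_analysis.
From mathcomp Require Import measurable_realfun.

Set Implicit Arguments.
Unset Strict Implicit.
Unset Printing Implicit Defensive.

Import Order.TTheory GRing.Theory Num.Theory.
Import numFieldNormedType.Exports.

Local Open Scope classical_set_scope.
Local Open Scope ring_scope.

(** * Measurability and norms on GL *)

(** For r < 1 the variable log|A_m x| need not have any exponential moment, so the exponential
    Markov inequality is available only after truncation. What survives is the moment of exp(c (log
    N)^r): since t^r is subadditive, a block of length m keeps the exponent c at the price of a
    factor K^m. Such factors vanish after taking logarithms and dividing by n^r, which is why C can
    be fixed before y although m depends on y. With T = N y, truncation loses a probability of order
    N exp(- c T^r); the drift error y / 4 per step costs s N y / 4 = (c / 8) T^r out of s T = (c /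
    2) T^r; the second-order term, of size N s^2, is negligible against T^r. The remaining 3 c / 8
    exceeds c / 3, and this gap absorbs the constants. The comparison of directions rests on the
    random bilinear form y h x: by irreducibility it cannot vanish almost surely at all times unless
    y or x is zero, and compactness of the unit spheres makes this quantitative. *)

Section measurability.
Variables (R : realType) (n : nat).

Lemma measurable_gtP d (T : measurableType d) (f : T -> R) :
  (forall a, measurable [set t | a < f t]) -> measurable_fun setT f.
Proof.
move=> mf; apply: (measurability _ (RGenOInfty.measurableE R)).
move=> _ [_ [a ->] <-]; rewrite setTI.
by rewrite (_ : _ @^-1` _ = [set t | a < f t])//; apply/seteqP; split => t /=;
  rewrite in_itv/= andbT.
Qed.

Lemma open_measurable_GL (U : set (GL R n)) : open U -> measurable U.
Proof. by move=> oU; apply: sub_sigma_algebra. Qed.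

Lemma GL_coord_continuous i j : continuous (fun g : GL R n => GLmx g i j).
Proof.
move=> g; apply: (@continuous_comp (GL R n) 'M[R]_n R (@GLmx R n) (fun M => M i j)).
  exact: initial_continuous.
exact: coord_continuous.
Qed.

Lemma measurable_GL_coord i j : measurable_fun setT (fun g : GL R n => GLmx g i j).
Proof.
apply: measurable_gtP => a; apply: open_measurable_GL.
have /continuousP/(_ [set x | a < x]) := @GL_coord_continuous i j.
by apply; exact: open_gt.
Qed.

(** An open set of matrices is a countable union of boxes with rational centres and radii 1 / (k +
    1), and lying in a box is a finite conjunction of conditions on the entries. *)
Lemma measurable_to_GL d (T : measurableType d) (h : T -> GL R n) :
  (forall i j, measurable_fun setT (fun t => GLmx (h t) i j)) ->
  measurable_fun setT h.
Proof.
move=> mh; apply: (measurability (@open (GL R n))) => //.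
move=> _ [_ [U oU <-] <-]; rewrite setTI.
pose box (p : 'M[rat]_n * nat) : set 'M[R]_n :=
  [set M | forall i j, `|M i j - ratr (p.1 i j)| < p.2.+1%:R^-1].
rewrite (_ : h @^-1` _ =
    \bigcup_(p : 'M[rat]_n * nat) (if `[< box p `<=` U >] then
      [set t | box p (GLmx (h t))] else set0)); last first.
  apply/seteqP; split => [t /= Ut|t [p _]]; last first.
    by case: asboolP => // pO bt; apply: pO.
  have /nbhs_ballP[e /= e0 eU] : nbhs (GLmx (h t)) U by exact: open_nbhs_nbhs.
  (* A radius below [e / 2], because the rational centre is itself only within that radius of [h t];
     the box then stays in the ball of radius [e]. *)
  have [k ke] : exists k : nat, k.+1%:R^-1 < e / 2.
    have [k] := @ltr_add_invr _ 0 (e / 2) (divr_gt0 e0 (ltr0n _ 2)).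
    by rewrite add0r => ?; exists k.
  have kp : 0 < k.+1%:R^-1 :> R by rewrite invr_gt0.
  have /choice[q0 q0P] : forall ij : 'I_n * 'I_n, exists q : rat,
      `|GLmx (h t) ij.1 ij.2 - ratr q| < k.+1%:R^-1.
    move: (k.+1%:R^-1 : R) kp => eps eps0 ij; have [|q] := @rat_in_itvoo R
      (GLmx (h t) ij.1 ij.2 - eps) (GLmx (h t) ij.1 ij.2 + eps).
      by rewrite ltrBlDr -addrA ltrDl addr_gt0.
    rewrite in_itv/= => /andP[q1 q2]; exists q.
    by rewrite ltr_norml; apply/andP; split => /=; lra.
  exists (\matrix_(i, j) q0 (i, j), k) => //.
  case: asboolP => [_ i j /=|]; first by rewrite mxE; exact: (q0P (i, j)).
  case=> M bM; apply: eU; split => // i j; rewrite /ball/= .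
  have := bM i j; have := q0P (i, j); rewrite /= !mxE => h1 h2.
  rewrite (_ : _ - _ = (GLmx (h t) i j - ratr (q0 (i, j))) -
    (M i j - ratr (q0 (i, j)))); last by ring.
  by apply: (le_lt_trans (ler_normB _ _));
    move: (k.+1%:R^-1 : R) ke h1 h2 => eps; lra.
apply: countable_bigcupT_measurable => [|p].
  exact: countableP.
case: asboolP => // _.
rewrite (_ : [set t | _] = \bigcap_(ij in [set: 'I_n * 'I_n])
    [set t | `|GLmx (h t) ij.1 ij.2 - ratr (p.1 ij.1 ij.2)| < p.2.+1%:R^-1]).
  apply: fin_bigcap_measurable => // -[i j] _ /=.
  have m1 : measurable_fun setT (fun t => `|GLmx (h t) i j - ratr (p.1 i j)|).
    by apply: measurableT_comp => //; apply: measurable_funB.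
  by have := measurable_fun_ltr m1 (@measurable_cst _ _ T R setT (p.2.+1%:R^-1 : R));
    move=> /(_ measurableT [set true] Logic.I); rewrite setTI.
apply/seteqP; split => [t b [i j] _ /=|t b i j]; first exact: b.
exact: (b (i, j)).
Qed.

Lemma measurable_GLmul d (T : measurableType d) (f h : T -> GL R n) :
  measurable_fun setT f -> measurable_fun setT h ->
  measurable_fun setT (fun t => GLmul (f t) (h t)).
Proof.
move=> mf mh; apply: measurable_to_GL => i j /=.
rewrite (_ : (fun t => _) = (fun t => \sum_k f t i k * h t k j)); last first.
  by apply/funext => t; rewrite mxE.
apply: measurable_sum => k; apply: measurable_funM.
  exact: (measurableT_comp (measurable_GL_coord i k) mf).
exact: (measurableT_comp (measurable_GL_coord k j) mh).
Qed.

End measurability.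

Section norms.
Variables (R : realType) (n : nat).
Implicit Types (x y : 'cV[R]_n) (g h : GL R n).

Lemma enorm_ge0 x : 0 <= enorm x.
Proof. exact: sqrtr_ge0. Qed.

Lemma sqr_enorm x : enorm x ^+ 2 = \sum_i x i 0 ^+ 2.
Proof. by rewrite sqr_sqrtr// sumr_ge0// => i _; exact: sqr_ge0. Qed.

Lemma enorm_eq0 x : (enorm x == 0) = (x == 0).
Proof.
apply/idP/eqP => [/eqP x0|->]; last by rewrite enorm0.
have /eqP : enorm x ^+ 2 = 0 by rewrite x0 expr0n.
rewrite sqr_enorm psumr_eq0 => [/allP x0'|i _]; last exact: sqr_ge0.
apply/matrixP => i j; rewrite ord1 mxE.
by have := x0' i (mem_index_enum _); rewrite sqrf_eq0 => /eqP.
Qed.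

Lemma enorm_gt0 x : (0 < enorm x) = (x != 0).
Proof. by rewrite lt_def enorm_eq0 enorm_ge0 andbT. Qed.

Lemma coord_le_enorm x i : `|x i 0| <= enorm x.
Proof.
rewrite -sqrtr_sqr ler_sqrt; last by rewrite sumr_ge0// => j _; exact: sqr_ge0.
by rewrite (bigD1 i)//= lerDl sumr_ge0// => j _; exact: sqr_ge0.
Qed.

Lemma enorm_le_sum x : enorm x <= \sum_i `|x i 0|.
Proof.
have s0 : 0 <= \sum_i `|x i 0| by apply: sumr_ge0.
rewrite -(ger0_norm s0) -sqrtr_sqr ler_sqrt ?sqr_ge0//.
rewrite expr2 mulr_suml; apply: ler_sum => i _.
rewrite -real_normK ?num_real// expr2 ler_wpM2l//.
by rewrite (bigD1 i)//= lerDl sumr_ge0.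
Qed.

Lemma opnorm_has_ub (g : 'M[R]_n) : has_ubound [set enorm (g *m x) | x in @usphere R n].
Proof.
exists (\sum_i \sum_j `|g i j|) => _ [x /= x1 <-].
apply: (le_trans (enorm_le_sum _)); apply: ler_sum => i _; rewrite mxE.
apply: (le_trans (ler_norm_sum _ _ _)); apply: ler_sum => j _.
by rewrite normrM ler_piMr// -x1; exact: coord_le_enorm.
Qed.

Lemma enorm_mulmx_le (g : 'M[R]_n) x : enorm (g *m x) <= opnorm g * enorm x.
Proof.
have [->|x0] := eqVneq x 0; first by rewrite mulmx0 enorm0 mulr0.
have ex0 : 0 < enorm x by rewrite enorm_gt0.
rewrite -ler_pdivrMr//; apply: ub_le_sup; first exact: opnorm_has_ub.
exists ((enorm x)^-1 *: x).
  by rewrite /usphere/= enormZ ger0_norm ?invr_ge0 ?ltW// mulVf// gt_eqF.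
by rewrite -scalemxAr enormZ ger0_norm ?invr_ge0 ?ltW// mulrC.
Qed.

Lemma GL_mulmx_neq0 g x : x != 0 -> g *m x != 0.
Proof.
apply: contra => /eqP gx0.
by rewrite -(mulKmx (GLmx_unit g) x) gx0 mulmx0.
Qed.

(** The cocycle [sigma_cocycle] on vectors instead of lines, which avoids [repr] until the invariant
    measure enters. *)
Definition logratio (g : 'M[R]_n) x : R := ln (enorm (g *m x) / enorm x).

Definition lognorm g : R := ln (GL_N g).

Lemma logratioM g h x : x != 0 ->
  logratio (GLmul g h) x = logratio g (h *m x) + logratio h x.
Proof.
move=> x0; rewrite /logratio -lnM ?posrE ?divr_gt0 ?enorm_gt0 ?GL_mulmx_neq0//.
congr ln; rewrite /= mulmxA mulrA divfK// ?enorm_eq0 ?GL_mulmx_neq0//.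
Qed.

Lemma logratio1 x : x != 0 -> logratio (GL1 R n) x = 0.
Proof. by move=> x0; rewrite /logratio mul1mx divff ?enorm_eq0// ln1. Qed.

Lemma logratioZ (g : 'M[R]_n) c x : c != 0 -> logratio g (c *: x) = logratio g x.
Proof.
move=> c0; rewrite /logratio -scalemxAr !enormZ invfM mulrACA divff ?normr_eq0//.
by rewrite mul1r.
Qed.

Lemma enorm_mulGL_le g x : enorm (g *m x) <= GL_N g * enorm x.
Proof.
apply: (le_trans (enorm_mulmx_le g x)); rewrite ler_wpM2r ?enorm_ge0//.
by rewrite le_max lexx.
Qed.

Lemma enorm_le_mulGL g x : enorm x <= GL_N g * enorm (g *m x).
Proof.
rewrite -{1}(mulKmx (GLmx_unit g) x); apply: (le_trans (enorm_mulmx_le _ _)).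
by rewrite ler_wpM2r ?enorm_ge0// le_max lexx orbT.
Qed.

End norms.

Section norms_pos.
Variables (R : realType) (n : nat).
Implicit Types (x y : 'cV[R]_n.+1) (g h : GL R n.+1).

Lemma usphere_nonempty : exists x, @usphere R n.+1 x.
Proof.
have e1 : 0 < enorm (const_mx 1 : 'cV[R]_n.+1).
  rewrite enorm_gt0; apply/eqP => /matrixP/(_ 0 0)/eqP.
  by rewrite !mxE oner_eq0.
exists ((enorm (const_mx 1 : 'cV[R]_n.+1))^-1 *: const_mx 1).
by rewrite /usphere/= enormZ ger0_norm ?invr_ge0 ?ltW// mulVf// gt_eqF.
Qed.

Lemma opnorm_le (g : 'M[R]_n.+1) c :
  (forall x, enorm (g *m x) <= c * enorm x) -> opnorm g <= c.
Proof.
move=> gc; have [x0 x01] := usphere_nonempty.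
apply: ge_sup; first by exists (enorm (g *m x0)); exists x0.
by move=> _ [x /= x1 <-]; rewrite (le_trans (gc x))// x1 mulr1.
Qed.

Lemma opnorm_gtP (g : 'M[R]_n.+1) a :
  a < opnorm g <-> exists2 x, @usphere R n.+1 x & a < enorm (g *m x).
Proof.
split => [|[x x1] /lt_le_trans]; last first.
  by apply; rewrite (le_trans (enorm_mulmx_le g x))// x1 mulr1.
have [x0 x01] := usphere_nonempty.
move=> /sup_gt[]; first by exists (enorm (g *m x0)); exists x0.
by move=> _ [x /= x1 <-] ax; exists x.
Qed.

Lemma GL_N_ge1 g : 1 <= GL_N g.
Proof.
rewrite leNgt; apply/negP => N1; have [x /= x1] := usphere_nonempty.
have N0 : 0 <= GL_N g.
  by have := le_trans (enorm_ge0 _) (enorm_mulGL_le g x); rewrite x1 mulr1.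
have := le_trans (enorm_le_mulGL g x) (ler_wpM2l N0 (enorm_mulGL_le g x)).
rewrite x1 mulr1; apply/negP; rewrite -ltNge.
exact: (le_lt_trans (ler_piMr N0 (ltW N1))).
Qed.

Lemma GL_N_gt0 g : 0 < GL_N g.
Proof. exact: lt_le_trans (GL_N_ge1 g). Qed.

Lemma lognorm_ge0 g : 0 <= lognorm g.
Proof. exact: ln_ge0 (GL_N_ge1 g). Qed.

Lemma GL_N_mul g h : GL_N (GLmul g h) <= GL_N g * GL_N h.
Proof.
rewrite /GL_N ge_max; apply/andP; split; apply: opnorm_le => x.
  rewrite /= -mulmxA (le_trans (enorm_mulGL_le g _))//.
  by rewrite -mulrA ler_wpM2l ?enorm_mulGL_le// ltW ?GL_N_gt0.
rewrite (le_trans (enorm_le_mulGL h _))// [GL_N g * _]mulrC -mulrA.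
apply: ler_wpM2l; first exact/ltW/GL_N_gt0.
apply: (le_trans (enorm_le_mulGL g _)).
rewrite !mulmxA -[g *m h]/(GLmx (GLmul g h)) mulmxV ?mul1mx//.
exact: GLmx_unit.
Qed.

Lemma lognormM g h : lognorm (GLmul g h) <= lognorm g + lognorm h.
Proof.
rewrite /lognorm -lnM ?posrE ?GL_N_gt0// ler_ln ?posrE ?mulr_gt0 ?GL_N_gt0//.
exact: GL_N_mul.
Qed.

Lemma lognorm1 : lognorm (GL1 R n.+1) = 0.
Proof.
apply/eqP; rewrite eq_le lognorm_ge0 andbT ln_le0//.
rewrite /GL_N ge_max; apply/andP; split; apply: opnorm_le => x;
  by rewrite /= ?invmx1 mul1mx mul1r.
Qed.

Lemma logratio_le g x : x != 0 -> `|logratio g x| <= lognorm g.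
Proof.
move=> x0; have ex : 0 < enorm x by rewrite enorm_gt0.
have egx : 0 < enorm (g *m x) by rewrite enorm_gt0 GL_mulmx_neq0.
rewrite ler_norml; apply/andP; split.
  rewrite -lnV ?posrE ?GL_N_gt0// ler_ln ?posrE ?invr_gt0 ?GL_N_gt0 ?divr_gt0//.
  rewrite ler_pdivlMr// mulrC ler_pdivrMr ?GL_N_gt0// mulrC.
  exact: enorm_le_mulGL.
rewrite ler_ln ?posrE ?GL_N_gt0 ?divr_gt0// ler_pdivrMr//.
exact: enorm_mulGL_le.
Qed.

Lemma measurable_enorm d (T : measurableType d) (v : T -> 'cV[R]_n.+1) :
  (forall i, measurable_fun setT (fun t => v t i 0)) ->
  measurable_fun setT (fun t => enorm (v t)).
Proof.
move=> mv; apply: (measurableT_comp (f := @Num.sqrt R)).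
  by apply: continuous_measurable_fun; exact: sqrt_continuous.
by apply: measurable_sum => i; exact: measurable_funX.
Qed.

Lemma measurable_GL_enorm x : measurable_fun setT (fun g => enorm (g *m x)).
Proof.
apply: measurable_enorm => i.
rewrite (_ : (fun t => _) = (fun g => \sum_k GLmx g i k * x k 0)); last first.
  by apply/funext => t; rewrite mxE.
apply: measurable_sum => k; apply: measurable_funM => //.
exact: measurable_GL_coord.
Qed.

Lemma measurable_logratio x : measurable_fun setT (fun g : GL R n.+1 => logratio g x).
Proof.
apply: measurableT_comp; first exact: measurable_ln.
by apply: measurable_funM => //; exact: measurable_GL_enorm.
Qed.

Lemma GL_enorm_continuous x : continuous (fun g : GL R n.+1 => enorm (g *m x)).
Proof.
move=> g.
apply: (@continuous_comp (GL R n.+1) R R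
  (fun g => \sum_i (GLmx g *m x) i 0 ^+ 2) (@Num.sqrt R)); last exact: sqrt_continuous.
rewrite (_ : (fun _ => _) =
  (fun g : GL R n.+1 => \sum_i (\sum_k GLmx g i k * x k 0) ^+ 2)); last first.
  by apply/funext => t; apply: eq_bigr => i _; rewrite mxE.
apply: continuous_big => [|i _]; first exact: add_continuous.
suff cS : continuous (fun g : GL R n.+1 => \sum_k GLmx g i k * x k 0).
  under [X in continuous X]eq_fun do rewrite expr2.
  by move=> h; exact: (cvgM (cS h) (cS h)).
apply: continuous_big => [|k _]; first exact: add_continuous.
by move=> h; exact: (cvgM (@GL_coord_continuous R n.+1 i k h) (cvg_cst _)).
Qed.

(** The superlevel sets of both norms are unions of open sets. For the inverse, the substitution x =
    g y turns |g^-1 x| > a |x| into a |g y| < |y|, which involves only [g]. *)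
Lemma measurable_lognorm : measurable_fun setT (@lognorm R n.+1).
Proof.
apply: measurableT_comp; first exact: measurable_ln.
apply: measurable_maxr; apply: measurable_gtP => a; apply: open_measurable_GL.
  rewrite (_ : [set t | _] = \bigcup_(x in @usphere R n.+1)
      [set g : GL R n.+1 | a < enorm (g *m x)]).
    apply: bigcup_open => x _.
    by have /continuousP/(_ [set x | a < x]) := @GL_enorm_continuous x; apply; exact: open_gt.
  by apply/seteqP; split => g /= /opnorm_gtP.
rewrite (_ : [set t | _] = \bigcup_(y in [set y | y != 0 ])
    [set g : GL R n.+1 | a * enorm (g *m y) < enorm y]).
  apply: bigcup_open => y _.
  have [->|a0] := eqVneq a 0.
    rewrite (_ : [set _ | _] = if 0 < enorm y then setT else set0).
      by case: ifP => _; [exact: openT|exact: open0].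
    by case: ifP => y0; apply/seteqP; split => g //=; rewrite mul0r y0.
  have /continuousP/(_ [set x | a * x < enorm y]) := @GL_enorm_continuous y; apply.
  have /continuousP/(_ [set x | x < enorm y]) := @mulrl_continuous R a.
  by apply; exact: open_lt.
apply/seteqP; split => g /=.
  move=> /opnorm_gtP[x /= x1 ax]; exists (invmx g *m x) => /=.
    have : x != 0 by rewrite -enorm_gt0 x1.
    by apply: contra => /eqP ix0; rewrite -(mulKVmx (GLmx_unit g) x) ix0 mulmx0.
  by rewrite mulKVmx ?GLmx_unit// x1 mulr1.
move=> [y /= y0 ay].
have gy0 : 0 < enorm (g *m y) by rewrite enorm_gt0 GL_mulmx_neq0.
have := enorm_mulmx_le (invmx g) (g *m y); rewrite mulKmx ?GLmx_unit// => yi.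
by rewrite -(ltr_pM2r gy0) (lt_le_trans ay).
Qed.

End norms_pos.

(** * Convolution and moments *)

Section convolution.
Variables (R : realType) (n : nat).
Local Notation G := (GL R n.+1).
Implicit Types (k : probability G R).

Definition GLmul_pair (z : G * G) : G := GLmul z.1 z.2.

Lemma measurable_GLmul_pair : measurable_fun setT GLmul_pair.
Proof. exact: measurable_GLmul. Qed.

HB.instance Definition _ :=
  isMeasurableFun.Build _ _ _ _ GLmul_pair measurable_GLmul_pair.

(** The right factor, of law [k2], acts first on vectors. *)
Definition conv k1 k2 : probability G R := distribution (k1 \x k2)%E GLmul_pair.

Lemma ge0_integral_conv k1 k2 (F : G -> \bar R) :
  measurable_fun setT F -> (forall g, (0 <= F g)%E) ->
  (\int[conv k1 k2]_g F g = \int[k2]_h \int[k1]_g F (GLmul g h))%E.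
Proof.
move=> mF F0; rewrite ge0_integral_distribution// fubini_tonelli2//.
  exact: measurableT_comp.
by move=> z; exact: F0.
Qed.

(** Both orders of integration are in use: fixing the right factor moves the starting vector, while
    fixing the left one, as in the comparison of directions, leaves the earlier factors random. *)
Lemma ge0_integral_conv1 k1 k2 (F : G -> \bar R) :
  measurable_fun setT F -> (forall g, (0 <= F g)%E) ->
  (\int[conv k1 k2]_g F g = \int[k1]_g \int[k2]_h F (GLmul g h))%E.
Proof.
move=> mF F0; rewrite ge0_integral_distribution// fubini_tonelli1//.
  exact: measurableT_comp.
by move=> z; exact: F0.
Qed.

Lemma measurable_mulr_preimage (A : set G) h :
  measurable A -> measurable [set g | A (GLmul g h)].
Proof.
move=> mA; have : measurable_fun setT (fun g : G => GLmul g h).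
  exact: measurable_GLmul.
by move=> /(_ measurableT A mA); rewrite setTI.
Qed.

Lemma measurable_mull_preimage (A : set G) g :
  measurable A -> measurable [set h | A (GLmul g h)].
Proof.
move=> mA; have : measurable_fun setT (fun h : G => GLmul g h).
  exact: measurable_GLmul.
by move=> /(_ measurableT A mA); rewrite setTI.
Qed.

Lemma measure_indic d (T : measurableType d) (k : {measure set T -> \bar R})
    (A : set T) : measurable A -> (k A = \int[k]_t (\1_A t)%:E)%E.
Proof. by move=> mA; rewrite integral_indic// setIT. Qed.

Lemma convE k1 k2 (A : set G) : measurable A ->
  (conv k1 k2 A = \int[k2]_h k1 [set g | A (GLmul g h)])%E.
Proof.
move=> mA; rewrite measure_indic// ge0_integral_conv//; last first.
- by apply/measurable_EFinP; exact: measurable_indic.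
apply: eq_integral => h _.
rewrite measure_indic//; exact: measurable_mulr_preimage.
Qed.

Lemma conv1E k1 k2 (A : set G) : measurable A ->
  (conv k1 k2 A = \int[k1]_g k2 [set h | A (GLmul g h)])%E.
Proof.
move=> mA; rewrite measure_indic// ge0_integral_conv1//; last first.
- by apply/measurable_EFinP; exact: measurable_indic.
apply: eq_integral => g _.
rewrite measure_indic//; exact: measurable_mull_preimage.
Qed.

Lemma measurable_mulr_measure k1 (A : set G) : measurable A ->
  measurable_fun setT (fun h => k1 [set g | A (GLmul g h)]).
Proof.
move=> mA.
have := measurable_fun_fubini_tonelli_G (m1 := k1)
  (fun z : G * G => (\1_A (GLmul z.1 z.2))%:E).
rewrite /fubini_G /= (_ : (fun y => _) = (fun h => k1 [set g | A (GLmul g h)])).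
  apply => //; apply/measurable_EFinP.
  apply: (measurableT_comp (f := \1_A : G -> R) (g := GLmul_pair)).
    exact: measurable_indic.
  exact: measurable_GLmul_pair.
apply/funext => h.
rewrite measure_indic//; exact: measurable_mulr_preimage.
Qed.

Lemma measurable_mull_measure k (A : set G) : measurable A ->
  measurable_fun setT (fun g => k [set h | A (GLmul g h)]).
Proof.
move=> mA.
have -> : (fun g => k [set h | A (GLmul g h)]) =
    fubini_F k (fun z : G * G => (\1_A (GLmul z.1 z.2))%:E).
  apply/funext => g; rewrite /fubini_F.
  rewrite measure_indic//; exact: measurable_mull_preimage.
apply: measurable_fun_fubini_tonelli_F => //.
apply/measurable_EFinP.
apply: (measurableT_comp (f := \1_A : G -> R) (g := GLmul_pair)).
  exact: measurable_indic.
exact: measurable_GLmul_pair.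
Qed.

Lemma GLmulA : associative (@GLmul R n.+1).
Proof. by move=> g h l; apply/val_inj; rewrite /= mulmxA. Qed.

Lemma GLmul1 g : GLmul g (GL1 R n.+1) = g.
Proof. by apply/val_inj; rewrite /= mulmx1. Qed.

Lemma GL1mul g : GLmul (GL1 R n.+1) g = g.
Proof. by apply/val_inj; rewrite /= mul1mx. Qed.

Lemma convA k1 k2 k3 (A : set G) : measurable A ->
  conv k1 (conv k2 k3) A = conv (conv k1 k2) k3 A.
Proof.
move=> mA; rewrite !convE// ge0_integral_conv//; last exact: measurable_mulr_measure.
apply: eq_integral => l _; rewrite convE//; last exact: measurable_mulr_preimage.
by apply: eq_integral => h _; under eq_fun do rewrite /= GLmulA.
Qed.

End convolution.

(** * Elementary inequalities for powers and exponentials *)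

Section real_inequalities.
Variable R : realType.
Implicit Types a b c r s t u x y : R.

Lemma powR_subadd r a b : 0 < r < 1 -> 0 <= a -> 0 <= b ->
  (a + b) `^ r <= a `^ r + b `^ r.
Proof.
move=> /andP[r0 r1] a0 b0.
have [ab0|abn0] := eqVneq (a + b) 0.
  by rewrite ab0 powR0 ?gt_eqF// addr_ge0 ?powR_ge0.
have ab0 : 0 < a + b by rewrite lt_def abn0 addr_ge0.
(* A ratio in [0, 1] is at most its power of exponent r < 1; the claim is the sum of the cases
   [c = a] and [c = b]. *)
have h c : 0 <= c -> c <= a + b -> c / (a + b) * (a + b) `^ r <= c `^ r.
  move=> c0 cab; have [->|cn0] := eqVneq c 0; first by rewrite !mul0r powR_ge0.
  have {}c0 : 0 < c by rewrite lt_def cn0.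
  have cab0 : 0 < c / (a + b) by rewrite divr_gt0.
  rewrite -[in leRHS](divfK abn0 c) (powRM _ (ltW cab0) (ltW ab0)).
  rewrite ler_wpM2r ?powR_ge0// ger1_powR//; last exact: ltW.
  by rewrite cab0 ler_pdivrMr// mul1r.
have := lerD (h a a0 _) (h b b0 _); rewrite -mulrDl -mulrDl divff// mul1r; apply.
  by rewrite lerDl.
by rewrite lerDr.
Qed.

(** With u = t^r, the square of t is u^(2 / r). For u >= 1 this is at most u^(m + 1), bounded
    through one term of the exponential series; for u <= 1 it is at most 1. Second moments of
    [lognorm] come from here. *)
Lemma sqr_le_expR_powR c r : 0 < c -> 0 < r ->
  exists2 K : R, 0 < K & forall t, 0 <= t -> t ^+ 2 <= K * expR (c * t `^ r).
Proof.
move=> c0 r0; have [m mr] : exists m : nat, 2 / r <= m.+1%:R.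
  exists (Num.truncn (2 / r)).
  exact: ltW (truncnS_gt _).
have cm : 0 < c ^+ m.+1 by exact: exprn_gt0.
have f0 : 0 < m.+1`!%:R :> R by rewrite ltr0n fact_gt0.
have q0 := divr_gt0 f0 cm.
exists (1 + m.+1`!%:R / c ^+ m.+1); first exact: addr_gt0.
move=> t t0; set u := t `^ r.
have u0 : 0 <= u by exact: powR_ge0.
have -> : t ^+ 2 = u `^ (2 / r).
  by rewrite /u -powRrM mulrCA divff ?gt_eqF// mulr1 powR_mulrn.
have cu0 : 0 <= c * u by rewrite mulr_ge0// ltW.
have e1 : 1 <= expR (c * u) by rewrite -expR0 ler_expR.
rewrite [leRHS]mulrDl mul1r; have [u1|/ltW u1] := leP 1 u.
  apply: (@le_trans _ _ (u ^+ m.+1)); first by rewrite -powR_mulrn// ler_powR.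
  apply: ler_wpDl; first exact: expR_ge0.
  rewrite mulrAC ler_pdivlMr// -exprMn [u * c]mulrC [leRHS]mulrC -ler_pdivrMr//.
  by rewrite (le_trans _ (expR_ge1Dxn m cu0))// lerDr.
rewrite (@le_trans _ _ 1)//.
  have r2 : 0 <= 2 / r by rewrite divr_ge0// ltW.
  have : u `^ (2 / r) <= 1 `^ (2 / r) by rewrite ge0_ler_powR ?nnegrE.
  by rewrite powR1.
apply: (le_trans e1); rewrite lerDl mulr_ge0 ?expR_ge0//; exact: ltW.
Qed.

Lemma expR_le_quadratic u : expR u <= 1 + u + u ^+ 2 * expR `|u|.
Proof.
(* This is 1 + v <= e^v at v = - u. Subtracting u gives e^u - 1 - u <= u (e^u - 1), and |e^u - 1| <=
   |u| e^|u| for either sign of u. *)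
have h : expR u - 1 <= u * expR u.
  have := expR_ge1Dx (- u); rewrite expRN -(ler_pM2l (expR_gt0 u)).
  by rewrite mulfV ?gt_eqF ?expR_gt0//; lra.
have e0 := expR_gt0 u.
have [u0|u0] := leP 0 u.
  rewrite ger0_norm//; nra.
have e1 : 1 <= expR `|u| by rewrite -expR0 ler_expR.
have := expR_ge1Dx u; nra.
Qed.

End real_inequalities.

Section integrability.
Context d (T : measurableType d) (R : realType).
Implicit Types (k : probability T R) (f g : T -> R).

Lemma dominated_integrable (k : {measure set T -> \bar R}) f g : measurable_fun setT f ->
  (forall t, `|f t| <= g t) ->
  k.-integrable setT (EFin \o g) -> k.-integrable setT (EFin \o f).
Proof.
move=> mf fg; apply: le_integrable => //; first exact/measurable_EFinP.
move=> t _ /=; rewrite lee_fin (le_trans (fg t))//.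
by rewrite ger0_norm// (le_trans _ (fg t)).
Qed.

Lemma ge0_integrable (k : {measure set T -> \bar R}) g : measurable_fun setT g ->
  (forall t, 0 <= g t) ->
  (\int[k]_t (g t)%:E < +oo)%E -> k.-integrable setT (EFin \o g).
Proof.
move=> mg g0 goo; apply/integrableP; split; first exact/measurable_EFinP.
rewrite (eq_integral (fun t => (g t)%:E))// => t _ /=.
by rewrite ger0_norm.
Qed.

Lemma integrable_cst_prob k (c : R) : k.-integrable setT (EFin \o cst c).
Proof. exact: finite_measure_integrable_cst. Qed.

Lemma Rintegral_EFin (k : {measure set T -> \bar R}) f : k.-integrable setT (EFin \o f) ->
  (\int[k]_t f t)%:E = (\int[k]_t (f t)%:E)%E.
Proof. by move=> fi; rewrite /Rintegral fineK//; exact: integrable_fin_num. Qed.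

Lemma Rintegral_cst_prob k (c : R) : \int[k]_t c = c.
Proof. by rewrite Rintegral_cst//= probability_setT mulr1. Qed.

Lemma Rintegral_indic_prob k (A : set T) : measurable A ->
  \int[k]_t \1_A t = fine (k A).
Proof. by move=> mA; rewrite /Rintegral integral_indic// setIT. Qed.

End integrability.

Section moments.
Variables (R : realType) (n : nat).
Local Notation G := (GL R n.+1).
Implicit Types (k : probability G R).

Lemma measurable_expR_lognorm (c r : R) :
  measurable_fun setT (fun g : G => expR (c * lognorm g `^ r)).
Proof.
apply: measurableT_comp; first exact: measurable_expR.
apply: measurable_funM => //; apply: (measurableT_comp (f := (@powR R)^~ r)).
  exact: measurable_powR.
exact: measurable_lognorm.
Qed.

Definition expmom c r k : \bar R := (\int[k]_g (expR (c * lognorm g `^ r))%:E)%E.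

(** Subadditivity of both [lognorm] and t^r makes the integrand submultiplicative, so the exponent
    [c] is preserved. *)
Lemma expmom_conv (c r : R) k1 k2 : 0 < r < 1 -> 0 < c ->
  (expmom c r (conv k1 k2) <= expmom c r k1 * expmom c r k2)%E.
Proof.
move=> r01 c0; rewrite /expmom.
have me := @measurable_expR_lognorm c r.
rewrite ge0_integral_conv//; last exact/measurable_EFinP.
rewrite -ge0_integralZl//; [|exact/measurable_EFinP|exact: integral_ge0].
  apply: ge0_le_integral => //.
  + by move=> h _; apply: integral_ge0.
  + apply: (measurable_fun_fubini_tonelli_G (m1 := k1)
      (fun z : G * G => (expR (c * lognorm (GLmul z.1 z.2) `^ r))%:E)) => //.
    apply/measurable_EFinP; apply: (measurableT_comp (f := fun g : G => _) me).
    exact: measurable_GLmul_pair.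
  + by apply: measurable_funeM; exact/measurable_EFinP.
  + move=> h _; rewrite muleC -ge0_integralZl//; [|exact/measurable_EFinP].
    apply: ge0_le_integral => //.
    * apply/measurable_EFinP; apply: (measurableT_comp (f := fun g : G => _) me).
      exact: measurable_GLmul.
    * by apply: measurable_funeM; exact/measurable_EFinP.
    * move=> g _; rewrite -EFinM lee_fin -expRD ler_expR -mulrDr.
      rewrite (ler_wpM2l (ltW c0))// addrC.
      apply: le_trans (powR_subadd r01 (lognorm_ge0 g) (lognorm_ge0 h)).
      have /andP[/ltW r0 _] := r01; apply: ge0_ler_powR => //.
      + by rewrite nnegrE lognorm_ge0.
      + by rewrite nnegrE addr_ge0 ?lognorm_ge0.
      + exact: lognormM.
Qed.

(** The law of A_j, free of the probability space. All estimates are made on these laws, and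
    [rprod_law] transfers them to the products of the [Y k]. *)
Fixpoint walk mu (j : nat) : probability G R :=
  if j is j'.+1 then conv mu (walk mu j') else (\d_(GL1 R n.+1))%R.

End moments.

Arguments conv : simpl never.
Arguments walk : simpl never.

Section walk.
Variables (R : realType) (n : nat).
Local Notation G := (GL R n.+1).
Implicit Types (mu k : probability G R).

Lemma conv_dirac_r k (A : set G) : measurable A ->
  conv k \d_(GL1 R n.+1) A = k A.
Proof.
move=> mA; rewrite convE// integral_dirac//; last exact: measurable_mulr_measure.
rewrite diracT mul1e; congr (k _); apply/seteqP; split => g /=; by rewrite GLmul1.
Qed.

Lemma conv_dirac_l k (A : set G) : measurable A ->
  conv \d_(GL1 R n.+1) k A = k A.
Proof.
move=> mA; rewrite convE// [RHS]measure_indic//; apply: eq_integral => h _.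
by rewrite /= /dirac !indicE; congr ((nat_of_bool _)%:R%:E); apply/idP/idP; rewrite !inE /= GL1mul.
Qed.

Lemma eq_conv k1 k2 k2' (A : set G) : measurable A ->
  (forall B, measurable B -> k2 B = k2' B) -> conv k1 k2 A = conv k1 k2' A.
Proof.
move=> mA k22; rewrite !conv1E//; apply: eq_integral => g _.
by apply: k22; exact: measurable_mull_preimage.
Qed.

Lemma eq_integral_measure (k k' : {measure set G -> \bar R}) (F : G -> \bar R) :
  (forall B, measurable B -> k B = k' B) ->
  (\int[k]_g F g = \int[k']_g F g)%E.
Proof. by move=> kk; apply: eq_measure_integral => A mA _; exact: kk. Qed.

Lemma walk0 mu : walk mu 0 = \d_(GL1 R n.+1) :> probability G R.
Proof. by []. Qed.

Lemma walkS mu j : walk mu j.+1 = conv mu (walk mu j).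
Proof. by []. Qed.

Lemma walkD mu i j (A : set G) : measurable A ->
  walk mu (i + j) A = conv (walk mu i) (walk mu j) A.
Proof.
elim: i A => [|i IH] A mA; first by rewrite conv_dirac_l.
rewrite addSn !walkS -convA//.
by apply: (@eq_conv mu (walk mu (i + j))) => // B; exact: IH.
Qed.

Lemma walk1 mu (A : set G) : measurable A -> walk mu 1 A = mu A.
Proof. exact: conv_dirac_r. Qed.

Lemma walkSr mu j (A : set G) : measurable A ->
  walk mu j.+1 A = conv (walk mu j) mu A.
Proof.
move=> mA; rewrite -(addn1 j) walkD//; apply: eq_conv => // B mB; exact: walk1.
Qed.

Lemma expmom_walk (c r K : R) mu j : 0 < r < 1 -> 0 < c -> 0 <= K ->
  (expmom c r mu <= K%:E)%E -> (expmom c r (walk mu j) <= (K ^+ j)%:E)%E.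
Proof.
move=> r01 c0 K0 muK; elim: j => [|j IH].
  have me := @measurable_expR_lognorm R n c r.
  rewrite /expmom walk0 integral_dirac//; last exact/measurable_EFinP.
  rewrite diracT mul1e lognorm1 powR0 ?mulr0 ?expR0//.
  by case/andP: r01 => r0 _; rewrite gt_eqF.
rewrite exprS EFinM walkS; apply: (le_trans (expmom_conv _ _ r01 c0)).
apply: lee_pmul => //; apply: integral_ge0 => g _; rewrite lee_fin; exact: expR_ge0.
Qed.

Lemma measurable_lognorm_sqr : measurable_fun setT (fun g : G => lognorm g ^+ 2).
Proof. by apply: measurable_funX; exact: measurable_lognorm. Qed.

(* (a + b)^2 <= (1 + t) a^2 + (1 + 1/t) b^2 with t = j turns the induction
   hypothesis j^2 M into (j + 1)^2 M. *)
Lemma sqrmom_walk (M : R) mu j : 0 <= M ->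
  (\int[mu]_g (lognorm g ^+ 2)%:E <= M%:E)%E ->
  (\int[walk mu j]_g (lognorm g ^+ 2)%:E <= (j%:R ^+ 2 * M)%:E)%E.
Proof.
move=> M0 muM; have ml := measurable_lognorm_sqr.
have mle : measurable_fun setT (fun g : G => (lognorm g ^+ 2)%:E) by exact/measurable_EFinP.
elim: j => [|[|j] IH].
- by rewrite walk0 integral_dirac//= diracT mul1e lognorm1 expr0n/= !mul0r.
- rewrite (eq_integral_measure _ (walk1 mu)) expr1n mul1r//.
set t : R := j.+1%:R.
have t0 : 0 < t by rewrite ltr0n.
rewrite walkS ge0_integral_conv//; last first.
  by move=> g; rewrite lee_fin sqr_ge0.
apply: (@le_trans _ _ (\int[walk mu j.+1]_h
    (((1 + t) * M)%:E + (1 + t^-1)%:E * (lognorm h ^+ 2)%:E))%E).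
  apply: ge0_le_integral => //.
  - by move=> h _; apply: integral_ge0 => g _; rewrite lee_fin sqr_ge0.
  - apply: (measurable_fun_fubini_tonelli_G (m1 := mu)
      (fun z : G * G => (lognorm (GLmul z.1 z.2) ^+ 2)%:E)); last first.
      by move=> z; rewrite lee_fin sqr_ge0.
    apply/measurable_EFinP; apply: (measurableT_comp (f := fun g : G => _) ml).
    exact: measurable_GLmul_pair.
  - by apply: emeasurable_funD => //; exact: measurable_funeM.
  - move=> h _; apply: (@le_trans _ _ (\int[mu]_g
        ((1 + t)%:E * (lognorm g ^+ 2)%:E + ((1 + t^-1) * lognorm h ^+ 2)%:E))%E).
      apply: ge0_le_integral => //.
      + by move=> g _; rewrite lee_fin sqr_ge0.
      + apply/measurable_EFinP; apply: (measurableT_comp (f := fun g : G => _) ml).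
        exact: measurable_GLmul.
      + by apply: emeasurable_funD => //; exact: measurable_funeM.
      + move=> g _; rewrite -EFinM -EFinD lee_fin.
        have := lognormM g h; have := lognorm_ge0 g; have := lognorm_ge0 h.
        have := lognorm_ge0 (GLmul g h).
        move: (lognorm g) (lognorm h) (lognorm (GLmul g h)) => a b ab ab0 b0 a0 abl.
        apply: (@le_trans _ _ ((a + b) ^+ 2)); first by rewrite ler_sqr ?nnegrE// addr_ge0.
        rewrite -subr_ge0.
        rewrite (_ : _ - _ = t * (a - t^-1 * b) ^+ 2); last by field; rewrite gt_eqF.
        by rewrite mulr_ge0 ?sqr_ge0 ?ltW.
    rewrite ge0_integralD//.
    - rewrite ge0_integralZl//; [|by move=> g _; rewrite lee_fin sqr_ge0
        |by rewrite lee_fin addr_ge0// ltW].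
      rewrite integral_cst//= probability_setT mule1 -EFinM.
      by rewrite leeD2r// EFinM lee_pmul2l// lte_fin addr_gt0.
    - move=> g _; rewrite mule_ge0// lee_fin ?sqr_ge0// addr_ge0// ltW//.
    - exact: measurable_funeM.
    - move=> g _; rewrite lee_fin mulr_ge0 ?sqr_ge0// addr_ge0// invr_ge0 ltW//.
rewrite ge0_integralD//; last 3 first.
- by move=> g _; rewrite lee_fin mulr_ge0// addr_ge0// ltW.
- by move=> g _; rewrite mule_ge0// lee_fin ?sqr_ge0// addr_ge0// invr_ge0 ltW.
- exact: measurable_funeM.
rewrite integral_cst//= probability_setT mule1.
have t1 : 0 < 1 + t^-1 by rewrite addr_gt0 ?invr_gt0.
rewrite ge0_integralZl//; [|by move=> g _; rewrite lee_fin sqr_ge0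
  |by rewrite lee_fin ltW].
apply: (@le_trans _ _ (((1 + t) * M)%:E + (1 + t^-1)%:E * (t ^+ 2 * M)%:E)%E).
  by rewrite leeD2l// lee_pmul2l.
rewrite -EFinM -EFinD lee_fin [j.+2%:R]mulrSr -/t le_eqVlt; apply/orP; left.
by apply/eqP; field; rewrite gt_eqF.
Qed.

End walk.

(** * Fubini for real-valued integrals *)

Section real_fubini.
Context d1 d2 (T1 : measurableType d1) (T2 : measurableType d2) (R : realType).
Variables (k1 : probability T1 R) (k2 : probability T2 R).

Lemma integrable_fubini_snd (f : T1 * T2 -> \bar R) :
  (k1 \x k2)%E.-integrable setT f -> k2.-integrable setT (fubini_G k1 f).
Proof.
move=> fi; have mf := measurable_int _ fi.
apply/integrableP; split; first exact: (measurable_fubini_G fi).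
apply: le_lt_trans ((integrable21ltyP _ _ mf).1 fi).
have mn : measurable_fun setT (abse \o f) by exact: measurableT_comp.
apply: ge0_le_integral => //.
- by apply: measurableT_comp => //; exact: (measurable_fubini_G fi).
- by apply: (measurable_fun_fubini_tonelli_G (m1 := k1) (abse \o f)) => // z; exact: abse_ge0.
- move=> t _; apply: le_abse_integral => //.
  by apply: (measurableT_comp mf); exact: measurable_pair2.
Qed.

(** Integrability of every section, not just of almost every one, identifies the inner real integral
    with the extended one at each point, which also gives its measurability. *)
Lemma Rintegral_prod (F : T1 * T2 -> R) :
  (forall h, k1.-integrable setT (EFin \o (fun g => F (g, h)))) ->
  (k1 \x k2)%E.-integrable setT (EFin \o F) ->
  k2.-integrable setT (EFin \o (fun h => \int[k1]_g F (g, h))) /\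
  \int[(k1 \x k2)%E]_z F z = \int[k2]_h \int[k1]_g F (g, h).
Proof.
move=> F1 Fi.
have FE : EFin \o (fun h => \int[k1]_g F (g, h)) = fubini_G k1 (EFin \o F).
  by apply/funext => h; rewrite /fubini_G /= Rintegral_EFin//; exact: F1.
split; first by rewrite FE; exact: integrable_fubini_snd.
by rewrite /Rintegral -integral21_prod_meas1// -FE.
Qed.

Lemma integrable_fst_prod (F : T1 -> R) : k1.-integrable setT (EFin \o F) ->
  (k1 \x k2)%E.-integrable setT (EFin \o (fun z => F z.1)).
Proof.
move=> /integrableP[mF Foo]; have mF1 := measurableT_comp mF measurable_fst.
apply/integrableP; split; first exact: (mF1 _ T2).
rewrite fubini_tonelli1//; last by apply: measurableT_comp => //; exact: (mF1 _ T2).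
rewrite /fubini_F/=; under eq_integral do rewrite integral_cst//= probability_setT mule1.
exact: Foo.
Qed.

Lemma integrable_snd_prod (F : T2 -> R) : k2.-integrable setT (EFin \o F) ->
  (k1 \x k2)%E.-integrable setT (EFin \o (fun z => F z.2)).
Proof.
move=> /integrableP[mF Foo]; have mF2 := measurableT_comp mF measurable_snd.
apply/integrableP; split; first exact: (mF2 _ T1).
rewrite fubini_tonelli2//; last by apply: measurableT_comp => //; exact: (mF2 _ T1).
rewrite /fubini_G/=; under eq_integral do rewrite integral_cst//= probability_setT mule1.
exact: Foo.
Qed.

End real_fubini.


(** * Mean logarithmic growth *)

Section drift.
Variables (R : realType) (n : nat).
Local Notation G := (GL R n.+1).
Implicit Types (mu k : probability G R) (x : 'cV[R]_n.+1).
Variables (c r : R).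
Hypotheses (r01 : 0 < r < 1) (c0 : 0 < c).

Definition tame k : Prop := (expmom c r k < +oo)%E.

Lemma tame_integrable k (C : R) (F : G -> R) : tame k -> measurable_fun setT F ->
  (forall g, `|F g| <= C * expR (c * lognorm g `^ r)) ->
  k.-integrable setT (EFin \o F).
Proof.
move=> tk mF FC; apply: (dominated_integrable mF FC).
apply: (@eq_integrable _ _ _ _ _ measurableT
  (fun g => C%:E * (EFin \o (fun g => expR (c * lognorm g `^ r))) g)%E) => //.
apply: integrableZl => //; apply: ge0_integrable => //.
exact: measurable_expR_lognorm.
Qed.

Lemma tame_sqr k : tame k ->
  k.-integrable setT (EFin \o (fun g : G => lognorm g ^+ 2)).
Proof.
move=> tk; have /andP[r0 _] := r01.
have [K K0 KP] := sqr_le_expR_powR c0 r0.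
apply: (tame_integrable (C := K)) => //; first exact: measurable_lognorm_sqr.
by move=> g; rewrite ger0_norm ?sqr_ge0// KP// lognorm_ge0.
Qed.

Lemma tame_lognorm k : tame k -> k.-integrable setT (EFin \o @lognorm R n.+1).
Proof.
move=> tk; apply: (@dominated_integrable _ _ _ k _ (fun g => 1 + lognorm g ^+ 2)).
- exact: measurable_lognorm.
- move=> g; rewrite ger0_norm ?lognorm_ge0//.
  by move: (lognorm g) => l; nra.
- have := integrableD measurableT (integrable_cst_prob k 1) (tame_sqr tk).
  by apply: eq_integrable.
Qed.

Lemma tame_logratio k x : tame k -> x != 0 ->
  k.-integrable setT (EFin \o (fun g : G => logratio g x)).
Proof.
move=> tk x0; apply: (dominated_integrable (g := @lognorm R n.+1)).
- exact: measurable_logratio.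
- by move=> g; exact: logratio_le.
- exact: tame_lognorm.
Qed.

Lemma tame_conv k1 k2 : tame k1 -> tame k2 -> tame (conv k1 k2).
Proof.
move=> t1 t2; apply: (le_lt_trans (expmom_conv _ _ r01 c0)).
by rewrite lte_mul_pinfty ?ge0_fin_numE//; apply: integral_ge0 => g _;
  rewrite lee_fin; exact: expR_ge0.
Qed.

Lemma tame_walk mu j : tame mu -> tame (walk mu j).
Proof.
move=> tmu; elim: j => [|j IH]; last exact: tame_conv.
rewrite /tame /expmom walk0 integral_dirac//; first by rewrite diracT mul1e ltry.
apply/measurable_EFinP; exact: measurable_expR_lognorm.
Qed.

(** [drift (walk mu m)] is the function D_m. *)
Definition drift k x : R := \int[k]_g logratio (GLmx g) x.

Lemma drift_le k x : tame k -> x != 0 ->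
  `|drift k x| <= \int[k]_g lognorm g.
Proof.
move=> tk x0; apply: (le_trans (le_normr_Rintegral _ (tame_logratio tk x0))) => //.
apply: le_Rintegral => //.
- exact: (integrable_norm (tame_logratio tk x0)).
- exact: tame_lognorm.
- by move=> g _; exact: logratio_le.
Qed.

(** The mean of the cocycle relation [logratioM]. The inner term [F] is measurable as a difference
    of two growths from the fixed vector [x], and integrable because [lognorm] of the left factor
    bounds it. *)
Lemma drift_conv k1 k2 x : tame k1 -> tame k2 -> x != 0 ->
  k2.-integrable setT (EFin \o (fun h : G => drift k1 (GLmx h *m x))) /\
  drift (conv k1 k2) x = \int[k2]_h drift k1 (GLmx h *m x) + drift k2 x.
Proof.
move=> t1 t2 x0.
pose F (z : G * G) := logratio (GLmx z.1) (GLmx z.2 *m x).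
have FE z : F z = logratio (GLmul z.1 z.2) x - logratio z.2 x.
  by rewrite logratioM// addrK.
have mlm : measurable_fun setT (fun z : G * G => logratio (GLmul z.1 z.2) x).
  apply: (measurableT_comp (f := fun g : G => logratio g x) (g := @GLmul_pair R n)).
    exact: measurable_logratio.
  exact: measurable_GLmul_pair.
have ml2 : measurable_fun setT (fun z : G * G => logratio z.2 x).
  apply: (measurableT_comp (f := fun g : G => logratio g x) (g := snd)) => //.
  exact: measurable_logratio.
have mF : measurable_fun setT F.
  rewrite (_ : F = (fun z => logratio (GLmul z.1 z.2) x - logratio z.2 x)).
    exact: measurable_funB.
  exact/funext.
have Fi : (k1 \x k2)%E.-integrable setT (EFin \o F).
  apply: (dominated_integrable (g := fun z : G * G => lognorm z.1)) => //.
    by move=> z; apply: logratio_le; exact: GL_mulmx_neq0.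
  by apply: integrable_fst_prod; exact: tame_lognorm.
have F1 h : k1.-integrable setT (EFin \o (fun g => F (g, h))).
  exact: (tame_logratio t1 (GL_mulmx_neq0 h x0)).
have [di dE] := Rintegral_prod F1 Fi.
split; first exact: di.
have l2i : (k1 \x k2)%E.-integrable setT (EFin \o (fun z : G * G => logratio z.2 x)).
  exact: (integrable_snd_prod _ (tame_logratio t2 x0)).
transitivity (\int[(k1 \x k2)%E]_z (F z + logratio z.2 x)).
  rewrite /drift /Rintegral integral_distribution.
  - by congr fine; apply: eq_integral => z _ /=; rewrite FE subrK.
  - by apply/measurable_EFinP; exact: measurable_logratio.
  - have := integrableD measurableT Fi l2i; apply: eq_integrable => //.
    by move=> z _; rewrite /= FE -EFinD subrK.
rewrite RintegralD// dE; congr (_ + _).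
have [|_ ->] := Rintegral_prod (F := fun z : G * G => logratio z.2 x) _ l2i.
  by move=> h; exact: (integrable_cst_prob k1 (logratio h x)).
by rewrite /drift; apply: eq_Rintegral => h _ /=; exact: (Rintegral_cst_prob k1 (logratio h x)).
Qed.

End drift.

(** * Stretched exponential deviations *)

Section asymptotics.
Variable R : realType.
Implicit Types y p M : R.

Lemma powR_natM_ge y p M : 0 < y -> 0 < p ->
  exists N0, forall N, (N0 <= N)%N -> M <= (N%:R * y) `^ p.
Proof.
move=> y0 p0; pose M' := Num.max M 1.
have M'0 : 0 < M' by rewrite lt_max ltr01 orbT.
exists (Num.truncn (M' `^ p^-1 / y)).+1 => N N0.
apply: (@le_trans _ _ M'); first by rewrite le_max lexx.
have -> : M' = (M' `^ p^-1) `^ p.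
  by rewrite -powRrM mulVf ?gt_eqF// powRr1// ltW.
have hN : M' `^ p^-1 <= N%:R * y.
  rewrite -ler_pdivrMr//; apply: ltW.
  by apply: (lt_le_trans (truncnS_gt _)); rewrite ler_nat.
apply: ge0_ler_powR => //; rewrite ?nnegrE ?powR_ge0//; first exact: ltW.
by apply: mulr_ge0 => //; exact: ltW.
Qed.

Lemma powR_natM_small y p e : 0 < y -> 0 < p -> 0 < e ->
  exists N0, forall N, (N0 <= N)%N -> (N%:R * y) `^ (- p) <= e.
Proof.
move=> y0 p0 e0; have [N0 N0P] := powR_natM_ge e^-1 y0 p0.
exists N0 => N /N0P h; rewrite powRN -(invrK e).
by rewrite lef_pV2// posrE ?invr_gt0// (lt_le_trans _ h)// invr_gt0.
Qed.

(** [T] is the truncation level and [s] the exponential parameter. The margin between 3/8 and 1/3 is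
    1/24: half of it absorbs the quadratic term, half the factor [2 * A]. The contribution of the
    truncated blocks, linear in [N], fits in the room between [c] and [c / 3]. *)
Lemma stretched_exp_asymptotics (c r y A K : R) : 0 < c -> 0 < r < 1 -> 0 < y ->
  0 <= A -> 0 <= K ->
  exists N0, forall N, (N0 <= N)%N ->
    let T := N%:R * y in let s := c / 2 * T `^ (r - 1) in
    [/\ 0 < T, s <= 1 &
     N.+1%:R * A * expR (- (c * T `^ r)) +
     A * expR (- (3 / 8 * c * T `^ r) + N%:R * (s ^+ 2 * K)) <=
     expR (- (c / 3 * T `^ r))].
Proof.
move=> c0 /andP[r0 r1] y0 A0 K0.
have p0 : 0 < 1 - r by rewrite subr_gt0.
have c20 : 0 < 2 / c by rewrite divr_gt0.
have K10 : 0 < K + 1 by lra.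
have cy : 0 < c / y by rewrite divr_gt0.
(* N s^2 K equals (c / 48) T^r times 12 (c / y) K T^(r - 1), so T^(r - 1) <= e brings it below (c /
   48) T^r. *)
pose e := (12 * (c / y) * (K + 1))^-1.
have eV0 : 0 < 12 * (c / y) * (K + 1) by rewrite mulr_gt0// mulr_gt0.
have e0 : 0 < e by rewrite invr_gt0.
have [N1 N1P] := powR_natM_small y0 p0 c20.
have [N2 N2P] := powR_natM_small y0 p0 e0.
have [N3 N3P] := powR_natM_ge (48 / c * (2 * A)) y0 r0.
have c30 : 0 < c / 3 by rewrite divr_gt0.
have [K2 K20 K2P] := sqr_le_expR_powR c30 r0.
(* T >= 4 A K2 / y and T^2 <= K2 exp((c / 3) T^r) together give 4 A N <= exp((c / 3) T^r). *)
have [N4 N4P] := powR_natM_ge (4 * A * K2 / y) y0 (@ltr01 R).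
exists (maxn (maxn N1 N2) (maxn (maxn N3 N4) 1)) => N.
rewrite !geq_max => /andP[/andP[/N1P h1 /N2P h2] /andP[/andP[/N3P h3 /N4P h4] N0]].
move=> T s; rewrite -/T in h1 h2 h3 h4.
have N0' : 1 <= N%:R :> R by rewrite ler1n.
have T0 : 0 < T by rewrite mulr_gt0// ltr0n.
have sT : s = c / 2 * T `^ (- (1 - r)) by rewrite /s opprB.
split => //.
  by rewrite sT mulrC -ler_pdivlMr ?divr_gt0// mul1r invf_div.
set X := T `^ r in h3 *.
have X0 : 0 <= X by exact: powR_ge0.
have sNE : N%:R * s ^+ 2 * K <= c / 48 * X.
  have XE : T * T `^ (- (1 - r)) = X by rewrite opprB mulr_powRB1// ltW.
  have -> : N%:R * s ^+ 2 * K = c ^+ 2 / 4 / y * K * (X * T `^ (- (1 - r))).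
    rewrite -XE sT (_ : N%:R = T / y); last by rewrite mulfK ?gt_eqF.
    by field; rewrite gt_eqF.
  move: h2; set q := T `^ _ => h2.
  have q0 : 0 <= q by exact: powR_ge0.
  have {}h2 : q * (12 * (c / y) * (K + 1)) <= 1.
    by move: h2; rewrite /e -[_^-1]mul1r ler_pdivlMr.
  rewrite (_ : _ * (X * q) = c / 48 * X * (12 * (c / y) * K * q)); last first.
    by field; rewrite gt_eqF.
  apply: ler_piMr; first by rewrite mulr_ge0// divr_ge0// ltW.
  apply: le_trans h2; have := mulr_ge0 (ltW cy) q0.
  by move: (c / y) cy => z z0; nra.
have e1 : A * expR (- (3 / 8 * c * X) + N%:R * (s ^+ 2 * K)) <=
    2^-1 * expR (- (c / 3 * X)).
  have -> : expR (- (c / 3 * X)) =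
      expR (c / 48 * X) * expR (- (3 / 8 * c * X) + c / 48 * X).
    by rewrite -expRD; congr expR; field.
  have : expR (- (3 / 8 * c * X) + N%:R * (s ^+ 2 * K)) <=
      expR (- (3 / 8 * c * X) + c / 48 * X).
    by rewrite ler_expR lerD2l mulrA.
  have : 2 * A <= expR (c / 48 * X).
    apply: (le_trans _ (expR_ge1Dx _)).
    have : c / 48 * (48 / c * (2 * A)) <= c / 48 * X.
      by apply: ler_wpM2l => //; rewrite divr_ge0 ?ltW.
    rewrite (_ : c / 48 * (48 / c * (2 * A)) = 2 * A); first by lra.
    by field; rewrite gt_eqF.
  move: (expR (c / 48 * X)) (expR_gt0 (- (3 / 8 * c * X) + N%:R * (s ^+ 2 * K))).
  move: (expR (- (3 / 8 * c * X) + N%:R * (s ^+ 2 * K))).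
  move: (expR (- (3 / 8 * c * X) + c / 48 * X)) => u v w v0 h vu; nra.
have e2 : N.+1%:R * A * expR (- (c * X)) <= 2^-1 * expR (- (c / 3 * X)).
  have E0 := expR_gt0 (c / 3 * X); set E := expR (c / 3 * X) in E0.
  have E1 : 1 <= E by rewrite -expR0 ler_expR (mulr_ge0 (ltW c30)).
  have -> : expR (- (c * X)) = expR (- (c / 3 * X)) / E ^+ 2.
    by rewrite expr2 -expRD -expRN -expRD; congr expR; field.
  have hT := K2P T (ltW T0); rewrite -/X -/E in hT.
  rewrite powRr1 in h4; last exact: ltW.
  have hE : N.+1%:R * A <= 2^-1 * E ^+ 2.
    have NT : N%:R = T / y by rewrite mulfK ?gt_eqF.
    have h5 : 4 * A * N%:R <= E.
      rewrite -(ler_pM2l K20) (le_trans _ hT)// NT expr2.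
      rewrite (_ : K2 * _ = (4 * A * K2 / y) * T); last by field; rewrite gt_eqF.
      by rewrite ler_wpM2r// ltW.
    have : N.+1%:R <= 2 * N%:R :> R by rewrite mulrSr; lra.
    move: (N.+1%:R : R) (N%:R : R) N0' h5 => N' N1' *; nra.
  by rewrite mulrA ler_pdivrMr ?exprn_gt0// [leRHS]mulrAC ler_wpM2r// expR_ge0.
have := lerD e2 e1; lra.
Qed.

End asymptotics.

Section deviation.
Variables (R : realType) (n : nat).
Local Notation G := (GL R n.+1).
Implicit Types (mu k : probability G R) (x : 'cV[R]_n.+1).
Variables (c r : R).
Hypotheses (r01 : 0 < r < 1) (c0 : 0 < c).

(** [a] collects the probabilities of exceeding the truncation level, [L] the Laplace transforms.
    Asking for every real [t] and every nonzero [x] makes the bound stable under convolution, where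
    both are replaced by random values. *)
Definition tail_bound (eta s a L : R) k := forall x t, x != 0 ->
  (k [set g : G | (t < eta * logratio g x)%R] <= (a + expR (- (s * t)) * L)%:E)%E.

Definition truncated_laplace (eta s T L : R) k := forall x, x != 0 ->
  (\int[k]_g (\1_[set g : G | (lognorm g <= T)%R] g *
     expR (s * (eta * logratio g x)))%:E <= L%:E)%E.

Lemma measurable_logratio_gt (eta t : R) x :
  measurable [set g : G | (t < eta * logratio g x)%R].
Proof.
have m1 : measurable_fun setT (fun g : G => eta * logratio g x).
  by apply: measurable_funM => //; exact: measurable_logratio.
have := measurable_fun_ltr (measurable_cst t) m1.
by move=> /(_ measurableT [set true] Logic.I); rewrite setTI.
Qed.

Lemma measurable_lognorm_le (T : R) : measurable [set g : G | (lognorm g <= T)%R].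
Proof.
have := measurable_fun_ler (@measurable_lognorm R n) (measurable_cst T).
by move=> /(_ measurableT [set true] Logic.I); rewrite setTI.
Qed.

Lemma measurable_laplace (eta s T : R) x : measurable_fun setT (fun g : G =>
  \1_[set g : G | (lognorm g <= T)%R] g * expR (s * (eta * logratio g x))).
Proof.
apply: measurable_funM; first by apply: measurable_indic; exact: measurable_lognorm_le.
apply: measurableT_comp => //; apply: measurable_funM => //.
by apply: measurable_funM => //; exact: measurable_logratio.
Qed.

(** Condition on the right factor [h]. Below the truncation level, the bound for [k1] applies with
    [t] lowered by the growth under [h], and integrating the exponential produces [L2]; above it,
    the probability is bounded by 1. *)
Lemma tail_bound_conv (eta s T a a2 L L2 : R) k1 k2 :
  0 <= a -> 0 <= L ->
  tail_bound eta s a L k1 -> truncated_laplace eta s T L2 k2 ->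
  (k2 [set g : G | (T < lognorm g)%R] <= a2%:E)%E ->
  tail_bound eta s (a + a2) (L * L2) (conv k1 k2).
Proof.
move=> a0 L0 k1a k2L k2a x t x0.
rewrite convE; last exact: measurable_logratio_gt.
have mT : measurable [set g : G | (T < lognorm g)%R].
  rewrite (_ : [set g | _] = ~` [set g : G | (lognorm g <= T)%R]).
    by apply: measurableC; exact: measurable_lognorm_le.
  by apply/seteqP; split => g /=; rewrite ltNge => /negP.
have ml := @measurable_laplace eta s T x.
have LE0 : 0 <= expR (- (s * t)) * L by rewrite mulr_ge0// expR_ge0.
apply: (@le_trans _ _ (\int[k2]_h ((a%:E + (\1_[set g : G | (T < lognorm g)%R] h)%:E) +
   (expR (- (s * t)) * L)%:E *
   (\1_[set g : G | (lognorm g <= T)%R] h *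
     expR (s * (eta * logratio h x)))%:E))%E).
  apply: ge0_le_integral => //.
  - by apply: measurable_mulr_measure; exact: measurable_logratio_gt.
  - apply: emeasurable_funD; last by apply: measurable_funeM; exact/measurable_EFinP.
    by apply: emeasurable_funD => //; apply/measurable_EFinP; exact: measurable_indic.
  - move=> h _.
    have -> : [set g | [set g0 : G | (t < eta * logratio g0 x)%R] (GLmul g h)] =
        [set g : G | (t - eta * logratio h x < eta * logratio g (h *m x))%R].
      apply/seteqP; split => g /=; rewrite logratioM// mulrDr ltrBlDr//.
    rewrite -EFinM -!EFinD !indicE.
    have [hT|hT] := leP (lognorm h) T.
      apply: (le_trans (k1a _ _ (GL_mulmx_neq0 h x0))).
      rewrite lee_fin (mem_set (hT : [set g : G | lognorm g <= T] h)) mul1r.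
      rewrite (_ : - (s * (t - eta * logratio h x)) =
        - (s * t) + s * (eta * logratio h x)); last by ring.
      by rewrite expRD mulrAC lerD2r lerDl ler0n.
    rewrite (mem_set (hT : [set g : G | T < lognorm g] h)).
    rewrite memNset/=; last by apply/negP; rewrite -ltNge.
    rewrite mul0r mulr0 addr0 (le_trans (probability_le1 _ _))//.
      exact: measurable_logratio_gt.
    by rewrite lee_fin lerDr.
rewrite ge0_integralD//; last 4 first.
- by move=> g _; rewrite -EFinD lee_fin addr_ge0.
- by apply: emeasurable_funD => //; apply/measurable_EFinP; exact: measurable_indic.
- move=> g _; rewrite -EFinM lee_fin mulr_ge0// mulr_ge0// expR_ge0//.
- by apply: measurable_funeM; exact/measurable_EFinP.
rewrite ge0_integralD//; last by apply/measurable_EFinP; exact: measurable_indic.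
rewrite integral_cst//= probability_setT mule1 -measure_indic//.
rewrite ge0_integralZl//; last exact/measurable_EFinP.
rewrite !EFinD; apply: leeD; first exact: leeD2l.
rewrite (mulrA _ L L2) [X in (_ <= X)%E]EFinM; apply: lee_wpmul2l; first by rewrite lee_fin.
exact: k2L.
Qed.

Lemma tail_bound_dirac (eta s : R) : 0 <= s ->
  tail_bound eta s 0 1 \d_(GL1 R n.+1).
Proof.
move=> s0 x t x0; rewrite add0r mulr1 /= /dirac indicE.
have [t0|t0] := leP 0 t.
  rewrite memNset; first by rewrite lee_fin expR_ge0.
  by rewrite /= logratio1// mulr0; apply/negP; rewrite -leNgt.
rewrite lee_fin; apply: (@le_trans _ _ 1).
  by rewrite lern1 leq_b1.
by rewrite -expR0 ler_expR oppr_ge0 mulr_ge0_le0// ltW.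
Qed.

Lemma eq_tail_bound (eta s a L : R) k k' :
  (forall A, measurable A -> k A = k' A) ->
  tail_bound eta s a L k -> tail_bound eta s a L k'.
Proof.
by move=> kk' ka x t x0; rewrite -kk'; [exact: ka|exact: measurable_logratio_gt].
Qed.

Lemma tail_bound_walk (eta s T a L : R) k j : 0 <= s -> 0 <= a -> 0 <= L ->
  truncated_laplace eta s T L k ->
  (k [set g : G | (T < lognorm g)%R] <= a%:E)%E ->
  tail_bound eta s (j%:R * a) (L ^+ j) (walk k j).
Proof.
move=> s0 a0 L0 kL ka; elim: j => [|j IH].
  by rewrite mul0r expr0; exact: tail_bound_dirac.
apply: (@eq_tail_bound _ _ _ _ (conv (walk k j) k)).
  by move=> A mA; rewrite -walkSr.
rewrite exprSr mulrSr mulrDl mul1r.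
apply: tail_bound_conv kL ka => //; first exact: mulr_ge0.
exact: exprn_ge0.
Qed.

Lemma walkM mu m j (A : set G) : measurable A ->
  walk mu (j * m) A = walk (walk mu m) j A.
Proof.
elim: j A => [//|j IH] A mA.
by rewrite mulSn walkD// walkS; apply: eq_conv.
Qed.

End deviation.

Section affine.
Context d (T : measurableType d) (R : realType) (k : probability T R).
Variables (f1 f2 : T -> R) (a b1 b2 : R).
Hypotheses (if1 : k.-integrable setT (EFin \o f1))
           (if2 : k.-integrable setT (EFin \o f2)).

Let ib1 : k.-integrable setT (EFin \o (fun t => b1 * f1 t)).
Proof. by have := integrableZl measurableT b1 if1; exact: eq_integrable. Qed.

Let ib2 : k.-integrable setT (EFin \o (fun t => b2 * f2 t)).
Proof. by have := integrableZl measurableT b2 if2; exact: eq_integrable. Qed.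

Let ia1 : k.-integrable setT (EFin \o (fun t => a + b1 * f1 t)).
Proof.
by have := integrableD measurableT (integrable_cst_prob k a) ib1; exact: eq_integrable.
Qed.

(** Most means below are bounded by integrating such a pointwise affine majorant; when one function
    suffices it is repeated with coefficient 0. *)
Lemma integrable_affine :
  k.-integrable setT (EFin \o (fun t => a + b1 * f1 t + b2 * f2 t)).
Proof. by have := integrableD measurableT ia1 ib2; exact: eq_integrable. Qed.

Lemma Rintegral_affine :
  \int[k]_t (a + b1 * f1 t + b2 * f2 t) = a + b1 * \int[k]_t f1 t + b2 * \int[k]_t f2 t.
Proof.
rewrite RintegralD// RintegralD//; last exact: (integrable_cst_prob k a).
rewrite RintegralZl// RintegralZl//; congr (_ + _ + _).
exact: (Rintegral_cst_prob k a).
Qed.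

End affine.

Section laplace_bounds.
Variables (R : realType) (n : nat).
Local Notation G := (GL R n.+1).
Implicit Types (mu k : probability G R) (x : 'cV[R]_n.+1).
Variables (c r : R).
Hypotheses (r01 : 0 < r < 1) (c0 : 0 < c).

Lemma measurable_lognorm_gt (T : R) : measurable [set g : G | (T < lognorm g)%R].
Proof.
have := measurable_fun_ltr (measurable_cst T) (@measurable_lognorm R n).
by move=> /(_ measurableT [set true] Logic.I); rewrite setTI.
Qed.

Lemma expmom_tail k M (T : R) : 0 <= T -> (expmom c r k <= M%:E)%E ->
  (k [set g : G | (T < lognorm g)%R] <= (M * expR (- (c * T `^ r)))%:E)%E.
Proof.
move=> T0 kM; have me := @measurable_expR_lognorm R n c r.
rewrite measure_indic; last exact: measurable_lognorm_gt.
apply: (@le_trans _ _ (\int[k]_g ((expR (- (c * T `^ r)))%:E *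
    (expR (c * lognorm g `^ r))%:E))%E).
  apply: ge0_le_integral => //.
  - by apply/measurable_EFinP; apply: measurable_indic; exact: measurable_lognorm_gt.
  - by apply: measurable_funeM; exact/measurable_EFinP.
  - move=> g _; rewrite -EFinM lee_fin -expRD indicE.
    have [gT|gT] := boolP (g \in _); last exact: expR_ge0.
    rewrite inE /= in gT; rewrite -expR0 ler_expR addrC subr_ge0.
    rewrite (ler_wpM2l (ltW c0))//; have /andP[/ltW r0 _] := r01.
    by apply: ge0_ler_powR; rewrite ?nnegrE ?lognorm_ge0// ltW.
rewrite ge0_integralZl//; last exact/measurable_EFinP.
by rewrite (mulrC M) EFinM; apply: lee_wpmul2l => //; rewrite lee_fin expR_ge0.
Qed.

(** The purpose of truncating: t^(r - 1) is nonincreasing, so up to level [T] the linear exponent is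
    dominated by half of the stretched one, which has a finite exponential moment. *)
Lemma truncation_le (T l : R) : 0 < T -> 0 <= l <= T ->
  c / 2 * T `^ (r - 1) * l <= c / 2 * l `^ r.
Proof.
move=> T0 /andP[l0 lT]; have c20 : 0 <= c / 2 by rewrite divr_ge0// ltW.
rewrite -mulrA ler_wpM2l//; have /andP[r0 r1] := r01.
have [->|ln0] := eqVneq l 0; first by rewrite mulr0 powR_ge0.
have {}l0 : 0 < l by rewrite lt_def ln0.
rewrite -(mulr_powRB1 (ltW l0) r0) mulrC ler_wpM2l ?(ltW l0)//.
rewrite -opprB !powRN lef_pV2 ?posrE ?powR_gt0//.
by apply: ge0_ler_powR; rewrite ?nnegrE ?(ltW l0) ?(ltW T0)// subr_ge0 ltW.
Qed.

(** For the incomplete block of fewer than [m] steps, on whose drift nothing is assumed. *)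
Lemma truncated_laplace_crude (eta T : R) k M : `|eta| = 1 -> 0 < T ->
  (expmom c r k <= M%:E)%E ->
  truncated_laplace eta (c / 2 * T `^ (r - 1)) T M k.
Proof.
move=> eta1 T0 kM x x0; apply: le_trans kM.
have s0 : 0 <= c / 2 * T `^ (r - 1) by rewrite mulr_ge0 ?powR_ge0// divr_ge0// ltW.
apply: ge0_le_integral => //.
- by apply/measurable_EFinP; exact: measurable_laplace.
- by apply/measurable_EFinP; exact: measurable_expR_lognorm.
move=> g _; rewrite lee_fin indicE.
have [gT|_] := boolP (g \in _); last by rewrite mul0r expR_ge0.
rewrite inE /= in gT; rewrite mul1r ler_expR.
apply: (@le_trans _ _ (c / 2 * T `^ (r - 1) * lognorm g)).
  apply: ler_wpM2l => //; apply: (le_trans (ler_norm _)).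
  by rewrite normrM eta1 mul1r logratio_le.
apply: (le_trans (truncation_le T0 _)); first by rewrite lognorm_ge0.
by rewrite ler_wpM2r ?powR_ge0// ler_pdivrMr// ler_peMr ?ltW//; lra.
Qed.

(** A second-order expansion around [b], whose first-order term is the drift. [K] depends neither on
    the level [T] nor on [e], so that [s ^+ 2 * K] becomes negligible against [s] as [T] grows. *)
Lemma truncated_laplace_drift (eta b : R) k : `|eta| = 1 -> tame c r k ->
  exists2 K : R, 0 <= K & forall T e : R, 0 < T -> c / 2 * T `^ (r - 1) <= 1 ->
  (forall x, x != 0 -> eta * drift k x <= b + e) ->
  let s := c / 2 * T `^ (r - 1) in
  truncated_laplace eta s T (expR (s * (b + e) + s ^+ 2 * K)) k.
Proof.
move=> eta1 tk.
have c20 : 0 < c / 2 by rewrite divr_gt0.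
have /andP[r0 r1] := r01.
have [K2 K20 K2P] := sqr_le_expR_powR c20 r0.
(* With Z the growth centred at b and l = [lognorm g]: Z^2 <= 2 l^2 + 2 b^2, l^2 <= K2 exp((c / 2)
   l^r), and exp(s |Z|) <= exp(|b|) exp((c / 2) l^r) below the truncation level. The product is at
   most C exp(c l^r). *)
pose C := expR `|b| * (2 * K2 + 2 * b ^+ 2).
have C0 : 0 <= C.
  by apply: mulr_ge0; [exact: expR_ge0|have := sqr_ge0 b; lra].
pose E (g : G) : R := expR (c * lognorm g `^ r).
have iE : k.-integrable setT (EFin \o E).
  apply: (@tame_integrable R n c r k 1) => //; first exact: measurable_expR_lognorm.
  by move=> g; rewrite mul1r ger0_norm// expR_ge0.
exists (C * \int[k]_g E g).
  by rewrite mulr_ge0// Rintegral_ge0// => g _; exact: expR_ge0.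
move=> T e T0 s1 kd s x x0.
have s0 : 0 <= s by rewrite mulr_ge0 ?powR_ge0// ltW.
have il := tame_logratio r01 c0 tk x0.
pose F g := expR (s * b) * (1 - s * b) + expR (s * b) * s * eta * logratio (GLmx g) x +
  expR (s * b) * s ^+ 2 * C * E g.
have iF := integrable_affine (expR (s * b) * (1 - s * b)) (expR (s * b) * s * eta)
  (expR (s * b) * s ^+ 2 * C) il iE.
apply: (@le_trans _ _ (\int[k]_g (F g)%:E)%E).
  apply: ge0_le_integral => //.
  - by apply/measurable_EFinP; exact: measurable_laplace.
  - exact: (measurable_int _ iF).
  move=> g _; rewrite lee_fin indicE.
  pose Z := eta * logratio (GLmx g) x - b.
  have Zl : `|Z| <= lognorm g + `|b|.
    by rewrite (le_trans (ler_normB _ _))// lerD2r normrM eta1 mul1r logratio_le.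
  have l0 := lognorm_ge0 g.
  have Z2 : Z ^+ 2 * (expR `|b| * expR (c / 2 * lognorm g `^ r)) <= C * E g.
    have -> : E g = expR (c / 2 * lognorm g `^ r) * expR (c / 2 * lognorm g `^ r).
      by rewrite -expRD /E; congr expR; field.
    have e1 : 1 <= expR (c / 2 * lognorm g `^ r).
      by rewrite -[leLHS]expR0 ler_expR mulr_ge0 ?powR_ge0// ltW.
    have := K2P _ l0; move: (expR (c / 2 * _)) e1 => w w1 lw.
    have w0 : 0 <= w by lra.
    rewrite /C mulrCA -[leRHS]mulrA; apply: ler_wpM2l; first exact: expR_ge0.
    rewrite [leRHS]mulrA; apply: ler_wpM2r => //.
    have : Z ^+ 2 <= 2 * lognorm g ^+ 2 + 2 * b ^+ 2.
      rewrite -(real_normK (num_real Z)) -(real_normK (num_real b)).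
      have := normr_ge0 Z; have := normr_ge0 b.
      move: (`|Z|) (`|b|) (lognorm g) Zl l0 => z b' l zl l0 b'0 z0.
      apply: (@le_trans _ _ ((l + b') ^+ 2)); first by rewrite ler_sqr ?nnegrE// addr_ge0.
      by have := sqr_ge0 (l - b'); nra.
    have := sqr_ge0 b; move: (lognorm g ^+ 2) (b ^+ 2) (Z ^+ 2) lw => *; nra.
  have -> : F g = expR (s * b) * (1 + s * Z + s ^+ 2 * (C * E g)).
    by rewrite /F /Z; ring.
  have H0 : s ^+ 2 * (Z ^+ 2 * (expR `|b| * expR (c / 2 * lognorm g `^ r))) <=
      s ^+ 2 * (C * E g) by rewrite ler_wpM2l// sqr_ge0.
  have [gT|gT] := boolP (g \in _).
    rewrite inE /= in gT; rewrite mul1r.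
    rewrite (_ : s * _ = s * b + s * Z); last by rewrite /Z; ring.
    rewrite expRD ler_wpM2l ?expR_ge0//.
    apply: (le_trans (expR_le_quadratic _)); rewrite lerD2l.
    apply: le_trans H0; rewrite exprMn -[leLHS]mulrA ler_wpM2l ?sqr_ge0//.
    rewrite ler_wpM2l ?sqr_ge0// -expRD ler_expR normrM (ger0_norm s0).
    apply: (@le_trans _ _ (s * (lognorm g + `|b|))); first exact: ler_wpM2l.
    rewrite mulrDr addrC lerD//; first by rewrite ler_piMl.
    by apply: truncation_le => //; rewrite l0.
  (* Beyond the truncation level the left side is 0, but the drift is a mean over the whole group,
     so the majorant must still be nonnegative there: up to the factor exp(s b) it dominates 1 + u +
     u^2. *)
  rewrite mul0r mulr_ge0 ?expR_ge0//.
  have : s ^+ 2 * Z ^+ 2 <= s ^+ 2 * (Z ^+ 2 * (expR `|b| * expR (c / 2 * lognorm g `^ r))).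
    rewrite ler_wpM2l ?sqr_ge0// ler_peMr ?sqr_ge0// -expRD -[leLHS]expR0 ler_expR.
    by rewrite addr_ge0// mulr_ge0 ?powR_ge0// ltW.
  rewrite -exprMn; move: (s * Z) => u; have := sqr_ge0 (u + 2^-1); nra.
rewrite -Rintegral_EFin// Rintegral_affine// lee_fin -/(drift k x).
apply: (@le_trans _ _ (expR (s * b) * (1 + (s * e + s ^+ 2 * (C * \int[k]_g E g))))).
  have := kd _ x0; have := expR_gt0 (s * b).
  move: (expR (s * b)) (drift k x) (\int[k]_g E g) => u v w u0 dv.
  rewrite (_ : _ + _ + _ = u * (1 + (s * (eta * v - b) + s ^+ 2 * (C * w)))); last by ring.
  by rewrite ler_wpM2l ?(ltW u0)// lerD2l lerD2r ler_wpM2l// lerBlDl.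
rewrite [s * (b + e)]mulrDr -addrA [leRHS]expRD ler_wpM2l ?expR_ge0//.
exact: expR_ge1Dx.
Qed.

End laplace_bounds.

Section stretched_deviation.
Variables (R : realType) (n : nat).
Local Notation G := (GL R n.+1).
Implicit Types (mu k : probability G R) (x : 'cV[R]_n.+1).
Variables (c r : R).
Hypotheses (r01 : 0 < r < 1) (c0 : 0 < c).

(* The j steps are grouped into blocks of length m, so that the drift
   hypothesis is only needed along blocks. Truncating each block at N y and
   choosing s = (c / 2) (N y)^(r - 1) in the exponential Markov inequality
   keeps the rate independent of m. *)
Lemma walk_deviation mu (eta b y : R) (m : nat) :
  tame c r mu -> (0 < m)%N -> `|eta| = 1 -> 0 < y ->
  (forall x, x != 0 -> eta * drift (walk mu m) x <= m%:R * (b + y / 4)) ->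
  exists N0, forall N j, (N0 <= N)%N -> (j <= N)%N -> forall x, x != 0 ->
    (walk mu j [set g : G | (N%:R * y + j%:R * b < eta * logratio g x)%R] <=
     (expR (- (c / 3 * (N%:R * y) `^ r)))%:E)%E.
Proof.
move=> tmu m0 eta1 y0 mud.
pose K := Num.max 1 (fine (expmom c r mu)).
have K1 : 1 <= K by rewrite le_max lexx.
have K0 : 0 <= K by apply: le_trans K1.
have muK : (expmom c r mu <= K%:E)%E.
  rewrite -[leLHS]fineK; first by rewrite lee_fin le_max lexx orbT.
  rewrite ge0_fin_numE//; apply: integral_ge0 => g _; rewrite lee_fin; exact: expR_ge0.
have tm := tame_walk r01 c0 m tmu.
have [K' K'0 K'P] := truncated_laplace_drift r01 c0 (m%:R * b) eta1 tm.
(* [K ^+ m] bounds the crude factor of the incomplete block and the weight of the truncated events.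
   The exponential pays, with [s <= 1], for the centring [q b] of the [q < m] steps outside complete
   blocks. *)
pose A := K ^+ m * expR (m%:R * `|b|).
have e1 : 1 <= expR (m%:R * `|b|) by rewrite -[leLHS]expR0 ler_expR mulr_ge0.
have Km1 i : 1 <= K ^+ i by exact: exprn_ege1.
have KA : K ^+ m <= A by rewrite ler_peMr// (le_trans _ (Km1 m)).
have A0 : 0 <= A by rewrite (le_trans _ KA)// (le_trans _ (Km1 m)).
have [N0 N0P] := stretched_exp_asymptotics c0 r01 y0 A0 K'0.
exists N0 => N j /N0P /=; set T := N%:R * y; set s := c / 2 * _.
move=> [T0 s1 bound] jN x x0; move: bound; rewrite -lee_fin; apply: le_trans.
have s0 : 0 <= s by rewrite mulr_ge0 ?powR_ge0// divr_ge0// ltW.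
set i := (j %/ m)%N; set q := (j %% m)%N.
have jE : j = (i * m + q)%N by exact: divn_eq.
have qm : (q < m)%N by rewrite ltn_mod.
have ij : (i <= N)%N by rewrite (leq_trans _ jN)// leq_div.
have sT : s * T = c / 2 * T `^ r.
  by have /andP[r0 _] := r01; rewrite /s -mulrA (mulrC _ T) mulr_powRB1// ltW.
pose a := K ^+ m * expR (- (c * T `^ r)).
have a0 : 0 <= a by rewrite mulr_ge0 ?expR_ge0// (le_trans _ (Km1 m)).
have am : (walk mu m [set g : G | (T < lognorm g)%R] <= a%:E)%E.
  apply: expmom_tail => //; first exact: ltW.
  exact: expmom_walk.
have aq : (walk mu q [set g : G | (T < lognorm g)%R] <= a%:E)%E.
  apply: (@le_trans _ _ (K ^+ q * expR (- (c * T `^ r)))%:E).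
    apply: expmom_tail => //; first exact: ltW.
    exact: expmom_walk.
  by rewrite lee_fin ler_wpM2r ?expR_ge0// ler_weXn2l// ltnW.
have Lq := truncated_laplace_crude r01 c0 eta1 T0
  (@expmom_walk R n c r K mu q r01 c0 K0 muK).
have mud' x' : x' != 0 -> eta * drift (walk mu m) x' <= m%:R * b + m%:R * (y / 4).
  by move=> x'0; rewrite -mulrDr mud.
pose L := expR (s * (m%:R * b + m%:R * (y / 4)) + s ^+ 2 * K').
have Lm : truncated_laplace eta s T L (walk mu m) := K'P T (m%:R * (y / 4)) T0 s1 mud'.
rewrite -/s in Lq.
have L0 : 0 <= L by exact: expR_ge0.
have tb1 := tail_bound_walk i s0 a0 L0 Lm am.
have tb2 : tail_bound eta s (i%:R * a) (L ^+ i) (walk mu (i * m)).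
  by apply: eq_tail_bound tb1 => B mB; rewrite walkM.
have ia0 : 0 <= i%:R * a by rewrite mulr_ge0.
have tb3 := tail_bound_conv ia0 (exprn_ge0 i L0) tb2 Lq aq.
have tb4 : tail_bound eta s (i%:R * a + a) (L ^+ i * K ^+ q) (walk mu j).
  by apply: eq_tail_bound tb3 => B mB; rewrite jE walkD.
apply: (le_trans (tb4 _ _ x0)); rewrite lee_fin; apply: lerD.
  rewrite -[X in _ + X]mul1r -mulrDl -mulrA natr1.
  apply: ler_pM => //; first by rewrite ler_nat.
  by rewrite ler_wpM2r// expR_ge0.
have -> : L ^+ i = expR (i%:R * (s * (m%:R * b + m%:R * (y / 4)) + s ^+ 2 * K')).
  by rewrite expRM_natl.
rewrite [leLHS]mulrA -expRD [leLHS]mulrC /A -[leRHS]mulrA -expRD.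
apply: ler_pM; rewrite ?expR_ge0//.
- by rewrite (le_trans _ (Km1 q)).
- by apply: ler_weXn2l => //; exact: ltnW.
rewrite ler_expR -/T.
have jR : j%:R = i%:R * m%:R + q%:R :> R by rewrite -natrM -natrD -jE.
have -> : - (s * (T + j%:R * b)) +
    i%:R * (s * (m%:R * b + m%:R * (y / 4)) + s ^+ 2 * K') =
    - (s * T) - s * (q%:R * b) + s * ((i%:R * m%:R) * y / 4) + i%:R * (s ^+ 2 * K').
  by rewrite jR; field.
(* The drift errors y / 4 over at most [N] steps cost a quarter of s T = (c / 2) T^r, which leaves
   (3 / 8) c T^r. *)
have h1 : s * ((i%:R * m%:R) * y / 4) <= s * T / 4.
  have imN : i%:R * m%:R <= N%:R :> R.
    by rewrite -natrM ler_nat (leq_trans _ jN)// [leqRHS]jE leq_addr.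
  have := ler_wpM2l s0 (ler_wpM2r (ltW y0) imN); rewrite -/T; lra.
have h2 : - (s * (q%:R * b)) <= m%:R * `|b|.
  apply: (le_trans (ler_norm _)); rewrite normrN normrM (ger0_norm s0) normrM normr_nat.
  rewrite -[leRHS]mul1r ler_pM// ?mulr_ge0// ler_wpM2r// ler_nat ltnW//.
have h3 : i%:R * (s ^+ 2 * K') <= N%:R * (s ^+ 2 * K').
  by rewrite ler_wpM2r ?ler_nat// mulr_ge0// sqr_ge0.
rewrite sT in h1 *; lra.
Qed.

End stretched_deviation.

(** * Consequences of irreducibility *)

Section subspace_of_pred.
Variables (K : fieldType) (V : vectType K).

(** Take a subspace of maximal dimension inside [Z]: the line spanned by a further vector of [Z]
    would enlarge it. *)
Lemma vspace_of_pred (Z : V -> Prop) :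
  Z 0 -> (forall a u v, Z u -> Z v -> Z (a *: u + v)) ->
  exists W : {vspace V}, forall v, v \in W <-> Z v.
Proof.
move=> Z0 ZD.
pose P (j : nat) := `[< exists2 W : {vspace V}, \dim W = j & forall v, v \in W -> Z v >].
have P0 : P 0%N.
  by apply/asboolP; exists 0%VS; [exact: dimv0|move=> v; rewrite memv0 => /eqP->].
have ub j : P j -> (j <= \dim {:V})%N by move=> /asboolP[W <- _]; rewrite dimvS ?subvf.
case: (ex_maxnP (ex_intro _ 0%N P0) ub) => m /asboolP[W Wm WZ] mmax.
exists W => v; split; first exact: WZ.
move=> Zv; apply/negPn/negP => vW.
have : P (\dim (W + <[v]>)%VS).
  apply/asboolP; exists (W + <[v]>)%VS => // u /memv_addP[w Ww [_ /vlineP[a ->] ->]].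
  by rewrite addrC; apply: ZD => //; exact: WZ.
move=> /mmax; rewrite -Wm leqNgt => /negP; apply.
rewrite ltn_neqAle dimvS ?addvSl// andbT; apply: contra vW => /eqP e.
have /eqP -> : W == (W + <[v]>)%VS by rewrite eqEdim addvSl e leqnn.
exact: (subvP (addvSr W <[v]>)) (memv_line v).
Qed.

End subspace_of_pred.

Section full_measure.
Variables (R : realType) (n : nat).
Local Notation G := (GL R n.+1).
Implicit Types (mu k : probability G R) (x v : 'cV[R]_n.+1).

(** The complement of [S] is open and null, so it misses the support. *)
Lemma Gamma_sub mu (S : set G) : closed S ->
  (forall g h, S g -> S h -> S (GLmul g h)) -> mu (~` S) = 0%E ->
  Gamma mu `<=` S.
Proof.
move=> cS mS S0; apply: smallest_sub; first by split.
move=> g gmu; apply: contrapT => Sg.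
have := gmu (~` S) _ Sg; rewrite S0 ltxx => h.
by have : false by apply: h; rewrite openC.
Qed.

Lemma GL_stabilizer_closed (W : {vspace 'cV[R]_n.+1}) :
  closed [set g : G | forall v, v \in W -> GLmx g *m v \in W].
Proof.
(* [W] is the kernel of [L], so its stability is the vanishing of functions linear in the entries of
   [g]. *)
pose L : 'End('cV[R]_n.+1) := (\1 - projv W)%VF.
have LW u : (u \in W) = (L u == 0).
  rewrite /L add_lfunE opp_lfunE id_lfunE subr_eq0; apply/idP/eqP => [uW|->].
    by rewrite projv_id.
  exact: memv_proj.
have LE (g : G) v i : (L (GLmx g *m v)) i 0 =
    \sum_a (\sum_b GLmx g a b * v b 0) * (L (delta_mx a 0)) i 0.
  rewrite {1}(_ : GLmx g *m v = \sum_a (\sum_b GLmx g a b * v b 0) *: delta_mx a 0).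
    by rewrite linear_sum summxE; apply: eq_bigr => a _; rewrite linearZ mxE.
  apply/matrixP => a' b'; rewrite ord1 mxE summxE [RHS](bigD1 a')//= [X in _ = _ + X]big1 ?addr0.
    by rewrite !mxE !eqxx mulr1.
  by move=> a aa'; rewrite !mxE eq_sym (negbTE aa') mulr0.
rewrite (_ : [set g | _] = \bigcap_(v in [set v | v \in W])
    \bigcap_(i in [set: 'I_n.+1]) [set g : G | (L (GLmx g *m v)) i 0 = 0]).
  apply: closed_bigI => v _; apply: closed_bigI => i _.
  have cL : continuous (fun g : G => (L (GLmx g *m v)) i 0).
    rewrite (_ : (fun _ => _) = fun g : G =>
      \sum_a (\sum_b GLmx g a b * v b 0) * (L (delta_mx a 0)) i 0); last first.
      by apply/funext => g; exact: LE.
    apply: continuous_big => [|a _]; first exact: add_continuous.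
    suff cS : continuous (fun g : G => \sum_b GLmx g a b * v b 0).
      by move=> h; exact: (cvgM (cS h) (cvg_cst _)).
    apply: continuous_big => [|b _]; first exact: add_continuous.
    by move=> h; exact: (cvgM (@GL_coord_continuous R n.+1 a b h) (cvg_cst _)).
  have /continuous_closedP/(_ [set 0]) := cL; apply; exact: closed_eq.
apply/seteqP; split => [g gW v /= vW i _|g gW v vW].
  by have := gW v vW; rewrite LW => /eqP Lg0; rewrite /= Lg0 mxE.
by rewrite LW; apply/eqP/matrixP => i j; rewrite ord1 mxE; exact: gW.
Qed.

End full_measure.

(** * Nondegeneracy of the random bilinear form *)

Section spreading_form.
Variables (R : realType) (n : nat).
Local Notation G := (GL R n.+1).
Implicit Types (mu k : probability G R) (y w : 'rV[R]_n.+1) (x v : 'cV[R]_n.+1).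

Definition pairing y (h : G) x : R := (y *m GLmx h *m x) 0 0.

(* The factor exp(- 2 lognorm h) bounds the coefficients of this quadratic form,
   so that its integrals are finite and continuous in y and x. *)
Definition spread y x (h : G) : R := pairing y h x ^+ 2 * expR (- (2 * lognorm h)).

Lemma pairingE y h x :
  pairing y h x = \sum_(p : 'I_n.+1 * 'I_n.+1) y 0 p.1 * x p.2 0 * GLmx h p.1 p.2.
Proof.
rewrite -(pair_bigA _ (fun i j => y 0 i * x j 0 * GLmx h i j))/= exchange_big/=.
rewrite /pairing mxE; apply: eq_bigr => j _; rewrite mxE mulr_suml.
by apply: eq_bigr => i _; rewrite mulrAC.
Qed.

Lemma expR_lognorm (h : G) : expR (lognorm h) = GL_N h.
Proof. by rewrite /lognorm lnK// posrE GL_N_gt0. Qed.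

Lemma GL_entry_le (h : G) i j : `|GLmx h i j| <= GL_N h.
Proof.
have d1 : enorm (delta_mx j 0 : 'cV[R]_n.+1) = 1.
  rewrite /enorm (bigD1 j)//= big1 ?addr0 => [|a aj].
    by rewrite mxE !eqxx expr1n sqrtr1.
  by rewrite mxE (negbTE aj) expr0n.
have := enorm_mulGL_le h (delta_mx j 0); rewrite d1 mulr1; apply: le_trans.
have := coord_le_enorm (GLmx h *m delta_mx j 0) i.
by rewrite -colE mxE.
Qed.

(** The coefficients of [spread] as a quadratic form in the products y_i x_j. *)
Definition cross (p q : 'I_n.+1 * 'I_n.+1) (h : G) : R :=
  GLmx h p.1 p.2 * GLmx h q.1 q.2 * expR (- (2 * lognorm h)).

Lemma measurable_cross p q : measurable_fun setT (cross p q).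
Proof.
apply: measurable_funM.
  by apply: measurable_funM; exact: measurable_GL_coord.
apply: measurableT_comp => //; apply: measurableT_comp => //.
by apply: measurable_funM => //; exact: measurable_lognorm.
Qed.

Lemma cross_le1 p q h : `|cross p q h| <= 1.
Proof.
rewrite normrM (ger0_norm (expR_ge0 _)) expRN ler_pdivrMr ?expR_gt0// mul1r.
rewrite mulr_natl mulr2n expRD expR_lognorm normrM ler_pM//; exact: GL_entry_le.
Qed.

Lemma integrable_cross k p q : k.-integrable setT (EFin \o cross p q).
Proof.
apply: (dominated_integrable (measurable_cross p q) (cross_le1 p q)).
exact: integrable_cst_prob.
Qed.

Lemma spreadE y x h : spread y x h = \sum_(p : 'I_n.+1 * 'I_n.+1) \sum_(q : 'I_n.+1 * 'I_n.+1)
  y 0 p.1 * x p.2 0 * (y 0 q.1 * x q.2 0) * cross p q h.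
Proof.
rewrite /spread pairingE expr2 mulr_suml mulr_suml; apply: eq_bigr => p _.
rewrite mulr_sumr mulr_suml; apply: eq_bigr => q _; rewrite /cross; ring.
Qed.

Lemma Rintegral_sum (I : Type) (s : seq I) (k : probability G R) (f : I -> G -> R) :
  (forall i, k.-integrable setT (EFin \o f i)) ->
  k.-integrable setT (EFin \o (fun h => \sum_(i <- s) f i h)) /\
  \int[k]_h (\sum_(i <- s) f i h) = \sum_(i <- s) \int[k]_h f i h.
Proof.
move=> fi; elim: s => [|i s [IHi IHE]].
  split.
    have := integrable_cst_prob k 0; apply: eq_integrable => // h _ /=.
    by rewrite big_nil.
  rewrite big_nil -[RHS](Rintegral_cst_prob k 0).
  by apply: eq_Rintegral => h _; rewrite big_nil.
split.
  have := integrableD measurableT (fi i) IHi; apply: eq_integrable => // h _ /=.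
  by rewrite big_cons EFinD.
rewrite big_cons -IHE -RintegralD//.
by apply: eq_Rintegral => h _; rewrite big_cons.
Qed.

Lemma integrable_cross_scale k a p q :
  k.-integrable setT (EFin \o (fun h => a * cross p q h)).
Proof.
by have := integrableZl measurableT a (integrable_cross k p q); exact: eq_integrable.
Qed.

Lemma spread_integral k y x :
  k.-integrable setT (EFin \o spread y x) /\
  \int[k]_h spread y x h = \sum_(p : 'I_n.+1 * 'I_n.+1) \sum_(q : 'I_n.+1 * 'I_n.+1)
    y 0 p.1 * x p.2 0 * (y 0 q.1 * x q.2 0) * \int[k]_h cross p q h.
Proof.
have -> : spread y x = fun h => \sum_(p : 'I_n.+1 * 'I_n.+1) \sum_(q : 'I_n.+1 * 'I_n.+1)
    y 0 p.1 * x p.2 0 * (y 0 q.1 * x q.2 0) * cross p q h.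
  by apply/funext => h; exact: spreadE.
have inner p := Rintegral_sum (index_enum _)
  (fun q => integrable_cross_scale k (y 0 p.1 * x p.2 0 * (y 0 q.1 * x q.2 0)) p q).
have [oi oE] := Rintegral_sum (index_enum _) (fun p => (inner p).1).
split; first exact: oi.
rewrite oE; apply: eq_bigr => p _; rewrite (inner p).2; apply: eq_bigr => q _.
by rewrite RintegralZl//; exact: integrable_cross.
Qed.

(** The integral is a polynomial in the coordinates, with the means of [cross] as coefficients. The
    second argument is a row vector so that both range over one normed space, whose unit sphere is
    compact. *)
Lemma spread_integral_continuous k :
  continuous (fun z : 'rV[R]_n.+1 * 'rV[R]_n.+1 => \int[k]_h spread z.1 z.2^T h).
Proof.
have c1 i : continuous (fun z : 'rV[R]_n.+1 * 'rV[R]_n.+1 => z.1 0 i).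
  move=> z; apply: (@continuous_comp _ _ _ fst (fun u : 'rV[R]_n.+1 => u 0 i)).
    exact: cvg_fst.
  exact: coord_continuous.
have c2 i : continuous (fun z : 'rV[R]_n.+1 * 'rV[R]_n.+1 => z.2 0 i).
  move=> z; apply: (@continuous_comp _ _ _ snd (fun u : 'rV[R]_n.+1 => u 0 i)).
    exact: cvg_snd.
  exact: coord_continuous.
rewrite (_ : (fun _ => _) = fun z : 'rV[R]_n.+1 * 'rV[R]_n.+1 =>
    \sum_(p : 'I_n.+1 * 'I_n.+1) \sum_(q : 'I_n.+1 * 'I_n.+1)
    z.1 0 p.1 * z.2 0 p.2 * (z.1 0 q.1 * z.2 0 q.2) * \int[k]_h cross p q h); last first.
  apply/funext => z; rewrite (spread_integral k z.1 z.2^T).2.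
  by apply: eq_bigr => p _; apply: eq_bigr => q _; rewrite !mxE.
apply: continuous_big => [|p _]; first exact: add_continuous.
apply: continuous_big => [|q _]; first exact: add_continuous.
move=> z; apply: cvgM; last exact: cvg_cst.
by apply: cvgM; apply: cvgM; [exact: c1|exact: c2|exact: c1|exact: c2].
Qed.

Lemma spread_ge0 y x h : 0 <= spread y x h.
Proof. by rewrite mulr_ge0 ?sqr_ge0 ?expR_ge0. Qed.

Lemma measurable_pairing y x : measurable_fun setT (fun h => pairing y h x).
Proof.
rewrite (_ : (fun _ => _) = fun h : G =>
    \sum_(p : 'I_n.+1 * 'I_n.+1) y 0 p.1 * x p.2 0 * GLmx h p.1 p.2).
  by apply: measurable_sum => p; apply: measurable_funM => //; exact: measurable_GL_coord.
by apply/funext => h; exact: pairingE.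
Qed.

Lemma measurable_pairing_neq0 y x : measurable [set h : G | pairing y h x != 0].
Proof.
have := measurable_fun_eqr (measurable_pairing y x) (measurable_cst (0 : R)).
move=> /(_ measurableT [set false] Logic.I); rewrite setTI.
by congr (measurable _); apply/seteqP; split => h /=; case: (_ == _).
Qed.

Lemma spread_integral_eq0 k y x : \int[k]_h spread y x h = 0 :> R ->
  k [set h : G | pairing y h x != 0] = 0%E.
Proof.
have [si _] := spread_integral k y x.
move=> s0; have : (\int[k]_h `|(spread y x h)%:E| = 0)%E.
  transitivity (\int[k]_h spread y x h)%:E; last by rewrite s0.
  rewrite Rintegral_EFin//.
  by apply: eq_integral => h _; rewrite gee0_abs// lee_fin spread_ge0.
have ms : measurable_fun setT (EFin \o spread y x) by exact: measurable_int si.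
move=> /(ae_eq_integral_abs k measurableT ms)[A [mA A0 hA]].
apply/eqP; rewrite eq_le measure_ge0 andbT -A0; apply: le_measure; rewrite ?inE//.
  exact: measurable_pairing_neq0.
move=> h /= ph; apply: hA => /(_ Logic.I)[] /eqP.
by rewrite /spread mulf_eq0 sqrf_eq0 (negbTE ph) gt_eqF// expR_gt0.
Qed.

End spreading_form.

Section irreducibility.
Variables (R : realType) (n : nat).
Local Notation G := (GL R n.+1).
Implicit Types (mu k : probability G R) (y : 'rV[R]_n.+1) (x v : 'cV[R]_n.+1).

Lemma pairingM y (h g : G) v : pairing y (GLmul h g) v = pairing y h (GLmx g *m v).
Proof. by rewrite /pairing /= !mulmxA. Qed.

Lemma pairing_linear y (h : G) (a : R) (u v : 'cV[R]_n.+1) :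
  pairing y h (a *: u + v) = a * pairing y h u + pairing y h v.
Proof. by rewrite /pairing mulmxDr -scalemxAr [LHS]mxE [X in X + _]mxE. Qed.

(** Condition on the first factor [g] applied to [v]: a nonnegative function with zero mean vanishes
    almost everywhere. *)
Lemma walk_null_shift mu y v j :
  walk mu j.+1 [set h : G | pairing y h v != 0] = 0%E ->
  mu.-negligible [set g : G |
    walk mu j [set h : G | pairing y h (GLmx g *m v) != 0] != 0%E].
Proof.
have mp u := @measurable_pairing_neq0 R n y u.
rewrite walkSr// convE// => int0.
pose f (g : G) : \bar R := walk mu j [set h | [set h : G | pairing y h v != 0] (GLmul h g)].
have fE g : f g = walk mu j [set h : G | pairing y h (GLmx g *m v) != 0].
  by congr (walk mu j _); apply/seteqP; split => h /=; rewrite pairingM.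
have mf : measurable_fun setT f by exact: measurable_mulr_measure.
have : (\int[mu]_g `|f g| = 0)%E.
  by rewrite -int0; apply: eq_integral => g _; rewrite gee0_abs.
move=> /(ae_eq_integral_abs mu measurableT mf)[A [mA A0 hA]].
exists A; split => // g /= fg0; apply: hA => /(_ Logic.I).
by rewrite /= fE => fg; rewrite fg eqxx in fg0.
Qed.

(** Otherwise the vectors v with y h v = 0 almost surely at all times form a subspace [W] containing
    [x]. Time 0 gives y v = 0 on [W], so [W] is proper; by [walk_null_shift] almost every [g], hence
    all of [Gamma mu], maps [W] into itself. *)
Lemma spread_positive mu y x : strongly_irreducible mu -> y != 0 -> x != 0 ->
  exists j, 0 < \int[walk mu j]_h spread y x h.
Proof.
move=> SI y0 x0; apply: contrapT => npos; apply: SI.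
have mp u := @measurable_pairing_neq0 R n y u.
pose Z v := forall j, walk mu j [set h : G | pairing y h v != 0] = 0%E.
have Zx : Z x.
  move=> j; apply: spread_integral_eq0; apply/eqP; rewrite eq_le.
  rewrite Rintegral_ge0 => [|h _]; last exact: spread_ge0.
  by rewrite andbT leNgt; apply/negP => pj; apply: npos; exists j.
have Z0 : Z 0.
  move=> j; rewrite (_ : [set h | _] = set0) ?measure0//.
  by apply/seteqP; split => h //=; rewrite /pairing mulmx0 mxE eqxx.
have ZD a u v : Z u -> Z v -> Z (a *: u + v).
  move=> Zu Zv j; apply/eqP; rewrite eq_le measure_ge0 andbT.
  apply: (@le_trans _ _ (walk mu j
    ([set h : G | pairing y h u != 0] `|` [set h : G | pairing y h v != 0]))).
    apply: le_measure; rewrite ?inE//; first exact: measurableU.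
    move=> h /= huv; apply: contrapT => /not_orP[/negP/negPn/eqP hu /negP/negPn/eqP hv].
    by move/eqP: huv; apply; rewrite pairing_linear hu hv mulr0 addr0.
  rewrite (_ : 0 = walk mu j [set h : G | (pairing y h u != 0)%R] +
    walk mu j [set h : G | (pairing y h v != 0)%R])%E; last by rewrite (Zu j) (Zv j) adde0.
  exact: measureU2.
have [W WZ] := vspace_of_pred Z0 ZD.
exists [:: W]; split => //.
  move=> _ /[!inE]/eqP->; split.
    by apply: contra x0 => /eqP W0; rewrite -memv0 -W0; exact/WZ.
  apply: contra y0 => /eqP Wf; apply/eqP/matrixP => a b; rewrite ord1 mxE.
  have : delta_mx b 0 \in W by rewrite Wf memvf.
  move=> /WZ/(_ 0%N); rewrite walk0 /= /dirac indicE.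
  have [_ /eqP|+ _] := boolP (_ \in _); first by rewrite eqe oner_eq0.
  rewrite notin_setE /= /pairing mulmx1 => /negP/negPn/eqP.
  by rewrite -colE mxE.
suff GW : Gamma mu `<=` [set g : G | forall v, v \in W -> GLmx g *m v \in W].
  move=> g /GW gW v [_ /[!inE]/eqP->] vW.
  by exists W; rewrite ?inE//; exact: gW.
have cS := @GL_stabilizer_closed R n W.
apply: Gamma_sub => //.
  by move=> g h gW hW v vW; rewrite /= -mulmxA; exact/gW/hW.
apply: measure_negligible.
  by apply: open_measurable_GL; rewrite openC.
(* Stability is tested on a basis; with the times [j] this leaves countably many negligible sets.
   Beyond the dimension of [W], [e i] is 0. *)
pose e i : 'cV[R]_n.+1 := (vbasis W)`_i.
have Ze i : Z (e i).
  have [iW|iW] := ltnP i (\dim W); last by rewrite /e nth_default// size_tuple.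
  by apply/WZ; apply: vbasis_mem; apply: mem_nth; rewrite size_tuple.
apply: (@negligibleS _ _ _ _ (\bigcup_i \bigcup_j [set g : G |
    walk mu j [set h : G | pairing y h (GLmx g *m e i) != 0] != 0%E])); last first.
  apply: negligible_bigcup => i; apply: negligible_bigcup => j.
  by apply: walk_null_shift; exact: Ze.
move=> g /= ngW; apply: contrapT => ne; apply: ngW => v vW.
have gZ i : GLmx g *m e i \in W.
  apply/WZ => j; apply: contrapT => /eqP nz; apply: ne.
  by exists i => //; exists j.
rewrite (coord_vbasis vW) mulmx_sumr; apply: memv_suml => i _.
by rewrite -scalemxAr memvZ.
Qed.

Lemma unit_rV_compact : compact [set y : 'rV[R]_n.+1 | `|y| = 1].
Proof.
apply: bounded_closed_compact.
  exists 1; split; first exact: num_real.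
  by move=> M M1 y /= ->; exact: ltW.
have /continuous_closedP/(_ [set 1]) := @norm_continuous R 'rV[R]_n.+1.
by apply; exact: closed_eq.
Qed.

(** Each pair of unit vectors has a time with positive mean, which by continuity serves a
    neighbourhood. Compactness gives a common number of times, and the sum over them attains a
    positive minimum. *)
Lemma spread_uniform mu : strongly_irreducible mu ->
  exists K : nat, exists2 a : R, 0 < a & forall y w : 'rV[R]_n.+1, `|y| = 1 -> `|w| = 1 ->
    a <= \sum_(j < K) \int[walk mu j]_h spread y w^T h.
Proof.
move=> SI.
pose S := [set y : 'rV[R]_n.+1 | `|y| = 1] `*` [set y : 'rV[R]_n.+1 | `|y| = 1].
have cS : compact S by apply: compact_setX; exact: unit_rV_compact.
pose F j (z : 'rV[R]_n.+1 * 'rV[R]_n.+1) := \int[walk mu j]_h spread z.1 z.2^T h.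
have cF j : continuous (F j) by exact: spread_integral_continuous.
have F0 j z : 0 <= F j z by apply: Rintegral_ge0 => h _; exact: spread_ge0.
have /compact_near_coveringP/(_ nat \oo (fun K z => 0 < \sum_(j < K) F j z)) := cS.
move=> /(_ eventually_filter) near_cov.
have [z [/= z1 z2]|K _ /(_ K (leqnn K)) KS] := near_cov _.
  have z10 : z.1 != 0 by rewrite -normr_gt0 z1.
  have z20 : z.2^T != 0.
    by rewrite -(trmx0 R) (inj_eq (@trmx_inj _ _ _)) -normr_gt0 z2.
  have [j jP] := spread_positive SI z10 z20.
  have oj : open [set z | 0 < F j z].
    have /continuousP/(_ [set t | 0 < t]) := cF j.
    by apply; exact: open_gt.
  exists ([set z | 0 < F j z], [set K | (j < K)%N]).
    by split; [exact: open_nbhs_nbhs|exists j.+1].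
  move=> [z' K] /= [zj jK]; rewrite (bigD1 (Ordinal jK))//=.
  by rewrite ltr_wpDr// sumr_ge0.
exists K.
pose H z := \sum_(j < K) F j z.
have cH : continuous H.
  apply: continuous_big => [|j _]; first exact: add_continuous.
  exact: cF.
have S0 : S !=set0.
  have e0 : (const_mx 1 : 'rV[R]_n.+1) != 0.
    by apply/eqP => /matrixP/(_ 0 0)/eqP; rewrite !mxE oner_eq0.
  pose u : 'rV[R]_n.+1 := `|const_mx 1 : 'rV[R]_n.+1|^-1 *: const_mx 1.
  have u1 : `|u| = 1 by rewrite normrZ normfV normr_id mulVf// normr_eq0.
  by exists (u, u); split.
have [z0 z0S z0P] := compact_EVT_min S0 cS (continuous_subspaceT cH).
exists (H z0); last by move=> y w y1 w1; apply: (z0P (y, w)); rewrite inE.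
by move: z0S; rewrite inE => /KS.
Qed.

End irreducibility.

Section hitting.
Variables (R : realType) (n : nat).
Local Notation G := (GL R n.+1).
Implicit Types (mu k : probability G R) (y w : 'rV[R]_n.+1) (x v z : 'cV[R]_n.+1).

Lemma mx_entry_le_norm y i : `|y 0 i| <= `|y|.
Proof.
rewrite [leRHS]mx_normrE.
by apply: (le_trans _ (le_bigmax _ _ (0, i))).
Qed.

Lemma enorm_le_norm x : enorm x <= n.+1%:R * `|x^T|.
Proof.
apply: (le_trans (enorm_le_sum x)).
apply: (@le_trans _ _ (\sum_(i < n.+1) `|x^T|)).
  apply: ler_sum => i _; have := mx_entry_le_norm x^T i.
  by rewrite mxE.
by rewrite sumr_const card_ord mulr_natl.
Qed.

Lemma spread_le y x h : `|y| = 1 -> `|x^T| = 1 -> spread y x h <= n.+1%:R ^+ 4.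
Proof.
move=> y1 x1; have N0 := GL_N_gt0 h.
have pN : `|pairing y h x| <= n.+1%:R ^+ 2 * GL_N h.
  rewrite pairingE (le_trans (ler_norm_sum _ _ _))//.
  apply: (@le_trans _ _ (\sum_(p : 'I_n.+1 * 'I_n.+1) GL_N h)).
    apply: ler_sum => p _; rewrite !normrM -[leRHS]mul1r ler_pM ?mulr_ge0//;
      last exact: GL_entry_le.
    rewrite -[leRHS]mulr1 ler_pM//; first by rewrite -y1 mx_entry_le_norm.
    by have := mx_entry_le_norm x^T p.2; rewrite mxE x1.
  by rewrite sumr_const card_prod card_ord -natrX mulr_natl -mulnn.
rewrite /spread mulrC expRN mulrC ler_pdivrMr ?expR_gt0//.
rewrite mulr_natl mulr2n expRD expR_lognorm -expr2.
rewrite -(real_normK (num_real (pairing y h x))) (exprM _ 2 2) -exprMn.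
by rewrite ler_sqr ?nnegrE ?mulr_ge0 ?sqr_ge0// ltW.
Qed.

(** Take a row y of [B] carrying a fixed part of |B z|. Then |B h x| >= |y h x|, which is comparable
    to |y| |x| with probability bounded below, because [spread] is bounded while its means over the
    times [j < K] add up to at least [a0]. *)
Lemma walk_hitting mu : strongly_irreducible mu ->
  exists K : nat, exists a C : R, 0 < a /\
  forall (B : G) x z (t : R), x != 0 -> z != 0 -> t + C < logratio B z ->
   (a%:E <= \sum_(j < K) walk mu j [set h : G | (t < logratio (GLmul B h) x)%R])%E.
Proof.
move=> /spread_uniform[K [a0 a00 Ka]].
pose N : R := n.+1%:R; have N0 : 0 < N by rewrite ltr0n.
pose D : R := N ^+ 4; have D0 : 0 < D by exact: exprn_gt0.
(* A reverse Markov inequality: the parts of the [K] means below the threshold [th] add up to at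
   most [a0 / 2], and [spread <= D], so the probabilities of exceeding [th] add up to at least
   [a0 / (2 * D)]. The successor avoids a division by zero. *)
pose th : R := a0 / (2 * K.+1%:R).
have th0 : 0 < th by rewrite divr_gt0// mulr_gt0.
have Kth : K%:R * th <= a0 / 2.
  have K0 : 0 < K.+1%:R :> R by rewrite ltr0n.
  rewrite (_ : _ * th = a0 / 2 * (K%:R / K.+1%:R)); last first.
    by rewrite /th; field; rewrite gt_eqF.
  apply: ler_piMr; first by rewrite divr_ge0// ltW.
  by rewrite ler_pdivrMr// mul1r ler_nat.
(* Two factors [N] come from the choice of the row and from |(B z)_i| <= N |y| |z|, the third from
   comparing the Euclidean norm of [x] with its supremum norm. *)
pose C := ln (N ^+ 3 / Num.sqrt th).
have sth : 0 < Num.sqrt th by rewrite sqrtr_gt0.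
exists K, (a0 / (2 * D)), C; split; first by rewrite divr_gt0// mulr_gt0.
move=> B x z t x0 z0 tC.
have ex0 : 0 < enorm x by rewrite enorm_gt0.
have ez0 : 0 < enorm z by rewrite enorm_gt0.
have Bz0 : 0 < enorm (GLmx B *m z) by rewrite enorm_gt0 GL_mulmx_neq0.
have [i Bi] : exists i, enorm (GLmx B *m z) <= N * `|(GLmx B *m z) i 0|.
  apply: contrapT => ni.
  have : \sum_i `|(GLmx B *m z) i 0| < \sum_(i < n.+1) (enorm (GLmx B *m z) / N).
    apply: ltr_sum; first by apply/hasP; exists 0; rewrite ?mem_index_enum.
    move=> i _; rewrite ltr_pdivlMr// mulrC ltNge; apply/negP => Bi; apply: ni.
    by exists i.
  rewrite sumr_const card_ord -[X in _ < X]mulr_natl mulrC divfK ?gt_eqF//.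
  by rewrite ltNge enorm_le_sum.
pose y := row i (GLmx B).
have yz : `|(GLmx B *m z) i 0| <= N * `|y| * enorm z.
  rewrite mxE (le_trans (ler_norm_sum _ _ _))//.
  apply: (@le_trans _ _ (\sum_(j < n.+1) `|y| * enorm z)).
    apply: ler_sum => j _; rewrite normrM ler_pM// ?coord_le_enorm//.
    by have := mx_entry_le_norm y j; rewrite mxE.
  by rewrite sumr_const card_ord -mulr_natl mulrA.
have ey : expR (t + C) < N ^+ 2 * `|y|.
  have /lt_le_trans : expR (t + C) < enorm (GLmx B *m z) / enorm z.
    by rewrite -[ltRHS]lnK ?posrE ?divr_gt0// ltr_expR.
  apply.
  rewrite ler_pdivrMr// (le_trans Bi)// expr2 -!mulrA ler_pM2l//.
  by rewrite mulrA.
have y0 : 0 < `|y|.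
  by have := lt_trans (expR_gt0 _) ey; rewrite pmulr_rgt0// exprn_gt0.
have xT0 : 0 < `|x^T| by rewrite normr_gt0 -(trmx0 R) (inj_eq (@trmx_inj _ _ _)).
pose yu : 'rV[R]_n.+1 := `|y|^-1 *: y; pose wu : 'rV[R]_n.+1 := `|x^T|^-1 *: x^T.
have yu1 : `|yu| = 1 by rewrite normrZ normfV normr_id mulVf// gt_eqF.
have wu1 : `|wu| = 1 by rewrite normrZ normfV normr_id mulVf// gt_eqF.
have pE h : pairing y h x = `|y| * `|x^T| * pairing yu h wu^T.
  rewrite /pairing /yu /wu linearZ /= trmxK -scalemxAr -!scalemxAl.
  by move: (y *m GLmx h *m x) => M; rewrite !mxE; field; rewrite !gt_eqF.
have hit h : th < spread yu wu^T h -> t < logratio (GLmul B h) x.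
  move=> thh.
  have p1 : Num.sqrt th < `|pairing yu h wu^T|.
    rewrite -sqrtr_sqr ltr_sqrt; last first.
      by move: (lt_trans th0 thh); rewrite /spread pmulr_lgt0 ?expR_gt0.
    apply: (lt_le_trans thh); rewrite /spread ler_piMr ?sqr_ge0//.
    by rewrite -[leRHS]expR0 ler_expR oppr_le0 mulr_ge0 ?lognorm_ge0.
  have Bhx : `|pairing y h x| <= enorm (GLmul B h *m x).
    have := coord_le_enorm (GLmul B h *m x) i.
    by rewrite /pairing /y -!row_mul [row _ _ _ _]mxE.
  rewrite /logratio -ltr_expR lnK ?posrE ?divr_gt0 ?enorm_gt0 ?GL_mulmx_neq0//.
  rewrite ltr_pdivlMr//; apply: lt_le_trans Bhx.
  rewrite pE normrM ger0_norm ?mulr_ge0//.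
  have {}ey : expR t * N < Num.sqrt th * `|y|.
    move: ey; rewrite expRD /C lnK ?posrE ?divr_gt0 ?exprn_gt0//.
    rewrite mulrA ltr_pdivrMr// => ey.
    rewrite -(ltr_pM2l (exprn_gt0 2 N0)).
    by rewrite (_ : _ * (expR t * N) = expR t * N ^+ 3);
      [rewrite (lt_le_trans ey)// mulrAC mulrA|ring].
  apply: (@le_lt_trans _ _ (expR t * (N * `|x^T|))).
    by rewrite ler_pM2l ?expR_gt0// enorm_le_norm.
  rewrite mulrA (@lt_trans _ _ (Num.sqrt th * `|y| * `|x^T|))// ?ltr_pM2r//.
  by rewrite -mulrA mulrC ltr_pM2l// mulr_gt0.
have mspread : measurable_fun setT (spread yu wu^T).
  apply: measurable_funM; first by apply: measurable_funX; exact: measurable_pairing.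
  apply: measurableT_comp => //; apply: measurableT_comp => //.
  by apply: measurable_funM => //; exact: measurable_lognorm.
pose E := [set h : G | (th < spread yu wu^T h)%R].
have mE : measurable E.
  have := measurable_fun_ltr (measurable_cst th) mspread.
  by move=> /(_ measurableT [set true] Logic.I); rewrite setTI.
have stepj j : \int[walk mu j]_h spread yu wu^T h <= th + D * fine (walk mu j E).
  have iE : (walk mu j).-integrable setT (EFin \o (\1_E : G -> R)).
    exact: integrable_indic.
  have ia := integrable_affine th D 0 iE iE.
  apply: (@le_trans _ _ (\int[walk mu j]_h (th + D * \1_E h + 0 * \1_E h))).
    apply: le_Rintegral => //; first exact: (spread_integral _ _ _).1.
    move=> h _; rewrite mul0r addr0 indicE.
    have [hE|] := boolP (h \in E).
      by rewrite mulr1 (le_trans (spread_le h yu1 _))// ?trmxK// lerDr ltW.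
    by rewrite notin_setE /E /= mulr0 addr0 => /negP; rewrite -leNgt.
  by rewrite Rintegral_affine// mul0r addr0 Rintegral_indic_prob.
have sumE : a0 / (2 * D) <= \sum_(j < K) fine (walk mu j E).
  have := Ka yu wu yu1 wu1.
  move=> /le_trans/(_ (ler_sum _ (fun (j : 'I_K) _ => stepj j))).
  rewrite big_split/= sumr_const card_ord -mulr_natl -mulr_sumr => h.
  by rewrite invfM mulrA ler_pdivrMr// mulrC; lra.
apply: (@le_trans _ _ (\sum_(j < K) walk mu j E)%E).
  rewrite (eq_bigr (fun j : 'I_K => (fine (walk mu j E))%:E)); last first.
    by move=> j _; rewrite fineK//; exact: fin_num_measure.
  by rewrite sumEFin lee_fin.
apply: lee_sum => j _; apply: le_measure; rewrite ?inE//.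
  have -> : [set h : G | (t < logratio (GLmul B h) x)%R] =
      [set h : G | [set g : G | (t < 1 * logratio g x)%R] (GLmul B h)].
    by apply/seteqP; split => h /=; rewrite mul1r.
  by apply: measurable_mull_preimage; exact: measurable_logratio_gt.
Qed.

End hitting.

(** * Uniform drift *)

Section excess.
Variables (R : realType) (n : nat).
Local Notation G := (GL R n.+1).
Implicit Types (mu k : probability G R) (x v z : 'cV[R]_n.+1).
Variables (c r : R).
Hypotheses (r01 : 0 < r < 1) (c0 : 0 < c).

Definition excess k (eta A : R) x : R := \int[k]_g Num.max 0 (eta * logratio (GLmx g) x - A).

Lemma integrable_excess k (eta A : R) x : tame c r k -> x != 0 -> `|eta| = 1 ->
  k.-integrable setT (EFin \o (fun g : G => Num.max 0 (eta * logratio g x - A))).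
Proof.
move=> tk x0 eta1.
have il := tame_lognorm r01 c0 tk.
apply: (@dominated_integrable _ _ _ k _ (fun g : G => `|A| + 1 * lognorm g + 0 * lognorm g)).
- apply: measurable_maxr => //; apply: measurable_funB => //.
  by apply: measurable_funM => //; exact: measurable_logratio.
- move=> g; rewrite mul1r mul0r addr0 ger0_norm ?le_max ?lexx// ge_max.
  rewrite addr_ge0 ?lognorm_ge0//=.
  apply: (le_trans (ler_norm _)); apply: (le_trans (ler_normB _ _)).
  by rewrite addrC lerD2l normrM eta1 mul1r logratio_le.
- exact: integrable_affine.
Qed.

(** On the event of probability at most [p] the overshoot is at most l + |A| with l = [lognorm g],
    and l + |A| <= th (l^2 + A^2) + 1 / (2 th). The free parameter [th] does the work of the
    Cauchy-Schwarz inequality. *)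
Lemma excess_le k (eta A S p th : R) x : tame c r k -> x != 0 -> `|eta| = 1 -> 0 < th ->
  \int[k]_g (lognorm g ^+ 2) <= S ->
  (k [set g : G | (A < eta * logratio g x)%R] <= p%:E)%E ->
  excess k eta A x <= th * (S + A ^+ 2) + p / (2 * th).
Proof.
move=> tk x0 eta1 th0 kS kp.
set E := [set g : G | _] in kp.
have mE : measurable E by exact: measurable_logratio_gt.
have iE : k.-integrable setT (EFin \o (\1_E : G -> R)) by exact: integrable_indic.
have is2 := tame_sqr r01 c0 tk.
have thV : 0 < (2 * th)^-1 by rewrite invr_gt0 mulr_gt0.
have ia := integrable_affine (th * A ^+ 2) th (2 * th)^-1 is2 iE.
apply: (@le_trans _ _ (\int[k]_g (th * A ^+ 2 + th * lognorm g ^+ 2 + (2 * th)^-1 * \1_E g))).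
  apply: le_Rintegral => //; first exact: integrable_excess.
  move=> g _; rewrite ge_max; apply/andP; split.
    by rewrite !addr_ge0// mulr_ge0 ?sqr_ge0//; exact: ltW.
  rewrite indicE; have [gE|gE] := boolP (g \in E).
    have : eta * logratio g x - A <= lognorm g + `|A|.
      apply: (le_trans (ler_norm _)); apply: (le_trans (ler_normB _ _)).
      by rewrite lerD2r normrM eta1 mul1r logratio_le.
    move=> /le_trans; apply; rewrite mulr1 -(real_normK (num_real A)).
    move: (lognorm g) `|A| => l a.
    rewrite -subr_ge0.
    rewrite (_ : _ - _ = th / 2 * (l - a) ^+ 2 + (th * (l + a) - 1) ^+ 2 / (2 * th)); last first.
      by field; rewrite gt_eqF.
    rewrite addr_ge0// mulr_ge0 ?sqr_ge0//; last exact: ltW.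
    by rewrite divr_ge0// ltW.
  move: gE; rewrite notin_setE /E /= => /negP; rewrite -leNgt => gA.
  rewrite mulr0 addr0; apply: (@le_trans _ _ 0); first by rewrite subr_le0.
  by rewrite addr_ge0// mulr_ge0 ?sqr_ge0//; exact: ltW.
rewrite Rintegral_affine// Rintegral_indic_prob//.
have kp' : fine (k E) <= p.
  by rewrite -lee_fin fineK//; exact: fin_num_measure.
rewrite mulrDr [th * S + _]addrC lerD//; first by rewrite lerD2l ler_pM2l.
by rewrite mulrC ler_wpM2r// invr_ge0 mulr_ge0 ?(ltW th0).
Qed.

Lemma drift_le_excess k A x : tame c r k -> x != 0 -> drift k x <= A + excess k 1 A x.
Proof.
move=> tk x0; have n1 : `|1 : R| = 1 by rewrite normr1.
have ie := integrable_excess A tk x0 n1.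
have ia := integrable_affine A 1 0 ie ie.
have -> : A + excess k 1 A x = A + 1 * excess k 1 A x + 0 * excess k 1 A x by ring.
rewrite -Rintegral_affine//; apply: le_Rintegral => //; first exact: (tame_logratio r01 c0).
by move=> g _; rewrite !mul1r mul0r addr0 -lerBlDl le_max lexx orbT.
Qed.

(** With X the growth, (X - A)^+ = (X - A) + (A - X)^+, and the left side is at least B - A on the
    event. A mean close to [A] and a small lower excess thus leave little mass above [B]. *)
Lemma upper_tail_le k (A B : R) x : tame c r k -> x != 0 -> A <= B ->
  fine (k [set g : G | (B < logratio g x)%R]) * (B - A) <=
  drift k x - A + excess k (-1) (- A) x.
Proof.
move=> tk x0 AB; have n1 : `|-1 : R| = 1 by rewrite normrN normr1.
have ie := integrable_excess (- A) tk x0 n1.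
have il := tame_logratio r01 c0 tk x0.
set E := [set g : G | _].
have mE : measurable E.
  rewrite (_ : E = [set g : G | (B < 1 * logratio g x)%R]); last first.
    by apply/seteqP; split => g; rewrite /E /= mul1r.
  exact: measurable_logratio_gt.
have iE : k.-integrable setT (EFin \o (\1_E : G -> R)) by exact: integrable_indic.
have i1 := integrable_affine 0 (B - A) 0 iE iE.
have i2 := integrable_affine (- A) 1 1 il ie.
have : \int[k]_g (0 + (B - A) * \1_E g + 0 * \1_E g) <=
    \int[k]_g (- A + 1 * logratio (GLmx g) x + 1 * Num.max 0 (-1 * logratio (GLmx g) x - - A)).
  apply: le_Rintegral => // g _; rewrite add0r mul0r addr0 !mul1r mulN1r opprK.
  set X := logratio _ _; set mx := Num.max _ _.
  have mx0 : 0 <= mx by rewrite le_max lexx.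
  have mxA : - X + A <= mx by rewrite le_max lexx orbT.
  rewrite indicE; have [gE|gE] := boolP (g \in E); last by rewrite mulr0; lra.
  by move: gE; rewrite inE /E /= mulr1 -/X => gB; lra.
rewrite !Rintegral_affine// Rintegral_indic_prob// -/(excess k (-1) (- A) x) -/(drift k x).
lra.
Qed.

(** Quadratic growth of the second moment gives a linear first moment through l <= t + l^2 / t with
    t = j + 1. *)
Lemma lognorm_walk_le mu (M : R) j : tame c r mu -> 0 <= M ->
  (\int[mu]_g (lognorm g ^+ 2)%:E <= M%:E)%E ->
  \int[walk mu j]_g (lognorm g ^+ 2) <= j%:R ^+ 2 * M /\
  \int[walk mu j]_g lognorm g <= j.+1%:R * (M + 1).
Proof.
move=> tmu M0 muM; have tj := tame_walk r01 c0 j tmu.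
have is2 := tame_sqr r01 c0 tj.
have S : \int[walk mu j]_g (lognorm g ^+ 2) <= j%:R ^+ 2 * M.
  by rewrite -lee_fin Rintegral_EFin//; exact: sqrmom_walk.
split => //; set t : R := j.+1%:R.
have t0 : 0 < t by rewrite ltr0n.
have ia := integrable_affine t t^-1 0 is2 is2.
apply: (@le_trans _ _ (\int[walk mu j]_g
    (t + t^-1 * lognorm g ^+ 2 + 0 * lognorm g ^+ 2))).
  apply: le_Rintegral => //; first exact: (tame_lognorm r01 c0).
  move=> g _; rewrite mul0r addr0 -(ler_pM2l t0) mulrDr mulVKf ?gt_eqF//.
  by have := sqr_ge0 (t - lognorm g); have := lognorm_ge0 g; nra.
rewrite Rintegral_affine// mul0r addr0 mulrDr mulr1 addrC lerD2r.
rewrite ler_pdivrMl// mulrA -expr2 (le_trans S)// ler_wpM2r//.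
by rewrite ler_sqr ?nnegrE ?ler_nat.
Qed.

End excess.

Section uniform_drift.
Variables (R : realType) (n : nat).
Local Notation G := (GL R n.+1).
Implicit Types (mu k : probability G R) (x v z : 'cV[R]_n.+1).
Variables (c r : R).
Hypotheses (r01 : 0 < r < 1) (c0 : 0 < c).
Variable mu : probability G R.
Hypothesis tmu : tame c r mu.
Variable M : R.
Hypotheses (M0 : 0 <= M) (muM : (\int[mu]_g (lognorm g ^+ 2)%:E <= M%:E)%E).

Definition lower_drift : set R :=
  [set b | exists2 m : nat, (0 < m)%N & forall x, x != 0 -> m%:R * b <= drift (walk mu m) x].

Let walk_sqr j : \int[walk mu j]_g (lognorm g ^+ 2) <= j%:R ^+ 2 * M.
Proof. exact: (lognorm_walk_le r01 c0 j tmu M0 muM).1. Qed.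

Let drift_walk_le j x : x != 0 -> `|drift (walk mu j) x| <= j.+1%:R * (M + 1).
Proof.
move=> x0; apply: (le_trans (drift_le r01 c0 (tame_walk r01 c0 j tmu) x0)).
exact: (lognorm_walk_le r01 c0 j tmu M0 muM).2.
Qed.

Let nzvec_ex : exists x : 'cV[R]_n.+1, x != 0.
Proof.
have [x x1] := @usphere_nonempty R n; exists x.
by rewrite -enorm_gt0 (x1 : enorm x = 1).
Qed.

Lemma lower_drift_has_sup : has_sup lower_drift.
Proof.
split.
  exists (- (2 * (M + 1))), 1%N => // x x0; rewrite mul1r.
  have := drift_walk_le 1 x0; rewrite ler_norml => /andP[+ _]; exact.
exists (2 * (M + 1)) => b [m m0 mb]; have [x x0] := nzvec_ex.
have mR : 1 <= m%:R :> R by rewrite ler1n.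
have := le_trans (mb x x0) (le_trans (ler_norm _) (drift_walk_le m x0)).
have M1 : 0 <= M + 1 :> R by rewrite addr_ge0.
rewrite mulrSr => h; rewrite -(ler_pM2l (_ : 0 < m%:R)) ?ltr0n//.
apply: (le_trans h); nra.
Qed.

Definition bottom_drift : R := sup lower_drift.

Local Notation beta := bottom_drift.

Lemma lower_drift_le b : lower_drift b -> b <= beta.
Proof. by move=> lb; apply: ub_le_sup => //; exact: lower_drift_has_sup.2. Qed.

Lemma drift_walkD i j x : x != 0 ->
  drift (walk mu (i + j)) x =
  \int[walk mu j]_h drift (walk mu i) (GLmx h *m x) + drift (walk mu j) x.
Proof.
move=> x0; have ti := tame_walk r01 c0 i tmu; have tj := tame_walk r01 c0 j tmu.
rewrite -(drift_conv r01 c0 ti tj x0).2 /drift /Rintegral; congr fine.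
by apply: eq_integral_measure => A mA; exact: walkD.
Qed.

(** Transfers near-minimality of a direction from one time to an earlier one, so that a single
    direction serves several times. *)
Lemma drift_walk_near i j x : x != 0 ->
  drift (walk mu j) x <= drift (walk mu (i + j)) x + i.+1%:R * (M + 1).
Proof.
move=> x0; have ti := tame_walk r01 c0 i tmu; have tj := tame_walk r01 c0 j tmu.
rewrite drift_walkD//.
suff : - (i.+1%:R * (M + 1)) <= \int[walk mu j]_h drift (walk mu i) (GLmx h *m x) by lra.
rewrite -[leLHS](Rintegral_cst_prob (walk mu j)); apply: le_Rintegral => //.
- exact: integrable_cst_prob.
- exact: (drift_conv r01 c0 ti tj x0).1.
move=> h _; have := drift_walk_le i (GL_mulmx_neq0 h x0).
by rewrite ler_norml => /andP[].
Qed.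

(* At times i + j with j < K, started from an almost minimizing direction, the
   growth is at most (beta + w) per step with high probability: it can hardly
   be less than beta per step, and its mean is close to beta per step. *)
Lemma near_minimizer (w eta : R) (K : nat) : 0 < w -> 0 < eta ->
  exists N0, forall i, (N0 <= i)%N -> exists2 x : 'cV[R]_n.+1, x != 0 & forall j, (j < K)%N ->
    fine (walk mu (i + j) [set g : G | (i%:R * (beta + w) < logratio g x)%R]) <= eta.
Proof.
move=> w0 eta0.
(* The final count is 6 i e against eta (i w / 2), whence e <= eta w / 12. *)
pose e : R := Num.min 1 (eta * w / 12).
have e0 : 0 < e by rewrite lt_min ltr01 divr_gt0// mulr_gt0.
have e1 : e <= 1 by rewrite ge_min lexx.
have ew : 12 * e <= eta * w.
  have : e <= eta * w / 12 by rewrite ge_min lexx orbT.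
  by rewrite ler_pdivlMr// mulrC.
have [b [m m0 mb] be] : exists2 b, lower_drift b & beta - e < b.
  by apply: sup_adherent => //; exact: lower_drift_has_sup.
have bb : b <= beta by apply: lower_drift_le; exists m.
pose Q : R := (`|beta| + 2) ^+ 2 + M.
have Q0 : 0 <= Q by rewrite addr_ge0// sqr_ge0.
(* Used as th / i: the moment term of [excess_le] is then at most 4 i th Q <= i e, and the choice of
   [p] below makes the other term equal to i e. *)
pose th : R := e / (4 * Q + 1).
have th0 : 0 < th by rewrite divr_gt0// ltr_wpDl// mulr_ge0.
have thQ : 4 * th * Q <= e.
  rewrite /th (_ : 4 * (e / _) * Q = e * (4 * Q / (4 * Q + 1))); last first.
    by field; rewrite gt_eqF// ltr_wpDl// mulr_ge0.
  rewrite ler_piMr ?(ltW e0)// ler_pdivrMr ?mul1r; last by rewrite ltr_wpDl// mulr_ge0.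
  by rewrite lerDl.
have n1 : `|-1 : R| = 1 by rewrite normrN normr1.
have mb' x : x != 0 -> -1 * drift (walk mu m) x <= m%:R * (- b + e / 4).
  move=> /mb h; have : 0 <= m%:R * (e / 4) :> R by rewrite mulr_ge0// divr_ge0// ltW.
  by lra.
have [N1 N1P] := walk_deviation r01 c0 tmu m0 n1 e0 mb'.
pose p : R := 2 * th * e.
have p0 : 0 < p by apply: mulr_gt0 => //; exact: mulr_gt0.
have r0 : 0 < r by case/andP: r01.
have c30 : 0 < c / 3 by rewrite divr_gt0.
have [N2 N2P] := powR_natM_ge (p^-1 / (c / 3)) e0 r0.
pose L : R := K.+1%:R * (M + 1) + 4 * K%:R * (`|beta| + 1).
have [N3 N3P] := powR_natM_ge (L / e) (@ltr01 R) (@ltr01 R).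
have [N4 N4P] := powR_natM_ge (2 * K%:R * `|beta| / w) (@ltr01 R) (@ltr01 R).
exists (maxn (maxn N1 N2) (maxn (maxn N3 N4) K.+1)) => i.
rewrite !geq_max => /andP[/andP[i1 i2] /andP[/andP[/N3P h3 /N4P h4] iK]].
have i0 : 0 < i%:R :> R by rewrite ltr0n (leq_trans _ iK).
rewrite mulr1 powRr1 ?(ltW i0)// in h3.
rewrite mulr1 powRr1 ?(ltW i0)// in h4.
have {}h3 : L <= i%:R * e by rewrite -ler_pdivrMr.
have {}h4 : 2 * K%:R * `|beta| <= i%:R * w by rewrite -ler_pdivrMr.
(* [beta + e] is not a lower drift, in particular not at time i + K. This time is later than all i +
   j, so the same [x] serves every [j < K]. *)
have [x x0 xb] : exists2 x : 'cV[R]_n.+1, x != 0 &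
    drift (walk mu (i + K)) x < (i + K)%:R * (beta + e).
  apply: contrapT => nx.
  have : beta + e <= beta.
    apply: lower_drift_le; exists (i + K)%N; first by rewrite addn_gt0 (leq_trans _ iK).
    by move=> x x0; rewrite leNgt; apply/negP => h; apply: nx; exists x.
  by rewrite gerDl leNgt e0.
exists x => // j jK; set N := (i + j)%N.
have iN : (i <= N)%N by exact: leq_addr.
have tN := tame_walk r01 c0 N tmu.
have NR : N%:R = i%:R + j%:R :> R by rewrite natrD.
have jR : j%:R <= K%:R :> R by rewrite ler_nat ltnW.
have Ki : K%:R <= i%:R :> R by rewrite ler_nat ltnW.
have j0 : 0 <= j%:R :> R by [].
have b0 := normr_ge0 beta.
have bn := ler_norm beta; have bn' := ler_norm (- beta); rewrite normrN in bn'.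
have Nx : drift (walk mu N) x <= (i%:R + K%:R) * (beta + e) + K.+1%:R * (M + 1).
  have := @drift_walk_near (K - j) N x x0.
  rewrite /N addnCA subnK ?(ltnW jK)// => /le_trans; apply; apply: lerD.
    by rewrite -natrD ltW.
  by rewrite ler_wpM2r ?addr_ge0// ler_nat ltnS leq_subr.
have NP : (walk mu N [set g : G | (N%:R * e + N%:R * - b < -1 * logratio g x)%R] <= p%:E)%E.
  apply: (le_trans (N1P N N (leq_trans i1 iN) (leqnn N) x x0)); rewrite lee_fin.
  have := N2P N (leq_trans i2 iN); rewrite ler_pdivrMr// mulrC.
  move: (c / 3 * _) => u pu; rewrite expRN -(invrK p) lef_pV2 ?posrE ?expR_gt0 ?invr_gt0//.
  by apply: (le_trans pu); have := expR_ge1Dx u; lra.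
(* A level slightly under N b, below which the growth falls with probability at most [p]. *)
pose A : R := N%:R * (b - e).
have AE : N%:R * e + N%:R * - b = - A by rewrite /A; ring.
rewrite AE in NP.
have thi0 : 0 < th / i%:R by rewrite divr_gt0.
have ex := excess_le r01 c0 tN x0 n1 thi0 (walk_sqr N) NP.
have pth : p / (2 * (th / i%:R)) = i%:R * e.
  by rewrite /p; field; rewrite !gt_eqF.
pose B : R := i%:R * (beta + w).
have bl : `|b - e| <= `|beta| + 2 by rewrite ler_norml; apply/andP; split; lra.
have N2i : N%:R <= 2 * i%:R :> R by rewrite NR; lra.
have exl : excess (walk mu N) (-1) (- A) x <= 2 * (i%:R * e).
  apply: (le_trans ex); rewrite pth sqrrN.
  have N22 : N%:R ^+ 2 <= 4 * i%:R ^+ 2 :> R.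
    have := ler0n R N; nra.
  have -> : N%:R ^+ 2 * M + A ^+ 2 = N%:R ^+ 2 * (M + (b - e) ^+ 2) by rewrite /A; ring.
  have bQ : M + (b - e) ^+ 2 <= Q.
    by rewrite addrC lerD2r -(real_normK (num_real (b - e))) ler_sqr ?nnegrE ?addr_ge0.
  have bQ0 : 0 <= M + (b - e) ^+ 2 by rewrite addr_ge0 ?sqr_ge0.
  have : N%:R ^+ 2 * (M + (b - e) ^+ 2) <= 4 * i%:R ^+ 2 * Q by rewrite ler_pM ?sqr_ge0.
  move=> /(ler_wpM2l (ltW thi0)).
  rewrite (_ : th / i%:R * (4 * i%:R ^+ 2 * Q) = i%:R * (4 * th * Q)); last first.
    by field; rewrite gt_eqF.
  by have := ler_wpM2l (ltW i0) thQ; lra.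
have AB : A + i%:R * w / 2 <= B.
  have : A <= N%:R * beta by rewrite /A ler_wpM2l//; lra.
  have : j%:R * beta <= K%:R * `|beta|.
    by apply: (@le_trans _ _ (j%:R * `|beta|)); [exact: ler_wpM2l|exact: ler_wpM2r].
  by rewrite /B NR; lra.
have iw0 : 0 < i%:R * w / 2 by rewrite divr_gt0// mulr_gt0.
have := upper_tail_le r01 c0 tN x0 (_ : A <= B).
move=> /(_ ltac:(lra)) ut.
set P := fine _ in ut *.
have P0 : 0 <= P by rewrite fine_ge0.
have h5 : P * (i%:R * w / 2) <= 6 * (i%:R * e).
  have : P * (i%:R * w / 2) <= P * (B - A) by rewrite ler_wpM2l//; lra.
  have DA : drift (walk mu N) x - A <= 4 * (i%:R * e).
    have : N%:R * (beta - 2 * e) <= A by rewrite /A ler_wpM2l//; lra.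
    have : (K%:R - j%:R) * beta <= K%:R * `|beta|.
      apply: (@le_trans _ _ ((K%:R - j%:R) * `|beta|)); first by apply: ler_wpM2l => //; lra.
      by apply: ler_wpM2r => //; lra.
    have : K%:R * e <= K%:R :> R by rewrite ler_piMr.
    have : j%:R * e <= K%:R :> R.
      by apply: le_trans jR; rewrite ler_piMr.
    have : 0 <= K%:R * `|beta| by rewrite mulr_ge0.
    move: Nx h3; rewrite NR /L; lra.
  by lra.
rewrite -(ler_pM2r iw0); apply: (le_trans h5).
by have := ler_wpM2l (ltW i0) ew; lra.
Qed.

(** The budget: the level [A] exceeds i beta by i w / 4 + C <= i w / 2, and each of the two terms of
    [excess_le] takes i w / 4. *)
Lemma uniform_drift_upper (w : R) : strongly_irreducible mu -> 0 < w ->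
  exists2 i : nat, (0 < i)%N & forall z, z != 0 ->
    drift (walk mu i) z <= i%:R * (beta + w).
Proof.
move=> /walk_hitting[K [a [C [a0 hit]]]] w0.
pose S : R := `|beta| + w + 1.
have S0 : 0 <= S by rewrite /S !addr_ge0// ltW.
pose Q : R := M + S ^+ 2.
have Q0 : 0 <= Q by rewrite addr_ge0// sqr_ge0.
have Q1 : 0 < 4 * Q + 1 by rewrite ltr_wpDl// mulr_ge0.
pose th : R := w / (4 * Q + 1).
have th0 : 0 < th by rewrite divr_gt0.
have thQ : th * Q <= w / 4.
  rewrite /th (_ : w / _ * Q = w / 4 * (4 * Q / (4 * Q + 1))); last first.
    by field; rewrite gt_eqF.
  rewrite ler_piMr ?divr_ge0 ?(ltW w0)// ler_pdivrMr// mul1r.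
  by rewrite lerDl.
pose q : R := th * w / 2.
have q0 : 0 < q by rewrite divr_gt0// mulr_gt0.
(* Summing over the [K] times and dividing by the hitting constant [a] leaves at most [q]. *)
pose eta : R := a * q / K.+1%:R.
have eta0 : 0 < eta by rewrite divr_gt0// mulr_gt0.
have w40 : 0 < w / 4 by rewrite divr_gt0.
have [N0 N0P] := near_minimizer K w40 eta0.
have [N1 N1P] := powR_natM_ge (`|C| / (w / 4) + `|C|) (@ltr01 R) (@ltr01 R).
pose i := (maxn N0 N1).+1.
have i0 : 0 < i%:R :> R by rewrite ltr0n.
have := N1P i (leqW (leq_maxr _ _)); rewrite mulr1 powRr1 ?(ltW i0)// => Ci.
have C0 := normr_ge0 C.
have Ci1 : `|C| <= i%:R.
  by apply: le_trans Ci; rewrite lerDr divr_ge0// ltW.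
have Ci2 : `|C| <= i%:R * (w / 4).
  by rewrite -ler_pdivrMr//; apply: le_trans Ci; rewrite lerDl.
have Cn := ler_norm C; have Cn' := ler_norm (- C); rewrite normrN in Cn'.
exists i => // z z0.
have [x x0 xP] := N0P i (leqW (leq_maxl _ _)).
have ti := tame_walk r01 c0 i tmu.
pose t : R := i%:R * (beta + w / 4).
pose A : R := t + C.
have n1 : `|1 : R| = 1 by rewrite normr1.
have Ap : (walk mu i [set g : G | (A < 1 * logratio g z)%R] <= q%:E)%E.
  set E := [set g : G | _].
  have mE : measurable E by exact: measurable_logratio_gt.
  pose F := [set g : G | (t < 1 * logratio g x)%R].
  have mF : measurable F by exact: measurable_logratio_gt.
  have FE (B : G) : [set h | F (GLmul B h)] = [set h : G | (t < logratio (GLmul B h) x)%R].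
    by apply/seteqP; split => h; rewrite /F /= mul1r.
  (* The hitting bound is integrated over the last [i] factors [B]: the product of [B] with [j]
     earlier factors has law [walk mu (i + j)], under which the growth of [x] is controlled. *)
  have h1 : (a%:E * walk mu i E <= \sum_(j < K) walk mu (i + j) F)%E.
    apply: (@le_trans _ _ (\int[walk mu i]_B
        (\sum_(j < K) walk mu j [set h | F (GLmul B h)]))%E); last first.
      rewrite ge0_integral_sum//; last first.
        by move=> j; exact: measurable_mull_measure.
      by apply: lee_sum => j _; rewrite walkD// conv1E.
    rewrite measure_indic// -ge0_integralZl//; last 2 first.
    - by apply/measurable_EFinP; exact: measurable_indic.
    - by rewrite lee_fin ltW.
    apply: ge0_le_integral => //.
    - by move=> B _; rewrite -EFinM lee_fin mulr_ge0// ltW.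
    - by apply: measurable_funeM; apply/measurable_EFinP; exact: measurable_indic.
    - by apply: emeasurable_sum => j; exact: measurable_mull_measure.
    - move=> B _; rewrite indicE; have [BE|_] := boolP (B \in E); last first.
        by rewrite mule0 sume_ge0.
      rewrite mule1; under eq_bigr do rewrite FE.
      apply: hit z0 _ => //; move: BE; rewrite inE /E /= mul1r; exact.
  rewrite -(@lee_pmul2l _ a%:E)//; apply: (le_trans h1).
  apply: (@le_trans _ _ (\sum_(j < K) eta%:E)%E).
    apply: lee_sum => j _; rewrite -[leLHS]fineK ?fin_num_measure// lee_fin.
    have := xP j (ltn_ord j); congr (fine (walk mu (i + j) _) <= _).
    by apply/seteqP; split => g; rewrite /F /= mul1r.
  rewrite sumEFin sumr_const card_ord -EFinM lee_fin -mulr_natl /eta mulrCA.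
  rewrite ler_piMr ?ler_pdivrMr ?mul1r ?ler_nat//.
  by rewrite mulr_ge0// ltW.
have thi0 : 0 < th / i%:R by rewrite divr_gt0.
have ex := excess_le r01 c0 ti z0 n1 thi0 (walk_sqr i) Ap.
apply: (le_trans (drift_le_excess r01 c0 A ti z0)).
have qth : q / (2 * (th / i%:R)) = i%:R * (w / 4).
  by rewrite /q; field; rewrite !gt_eqF.
rewrite qth in ex.
have Abs : A ^+ 2 <= (i%:R * S) ^+ 2.
  have b0 := normr_ge0 beta; have bn := ler_norm beta.
  have bn' := ler_norm (- beta); rewrite normrN in bn'.
  have hb := ler_wpM2l (ltW i0) bn; have hb' := ler_wpM2l (ltW i0) bn'.
  have hw := ler_wpM2l (ltW i0) (ltW w0).
  rewrite -(real_normK (num_real A)) ler_sqr ?nnegrE//; last by rewrite mulr_ge0// ltW.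
  by rewrite ler_norml /A /t /S; apply/andP; split; lra.
have : th / i%:R * (i%:R ^+ 2 * M + A ^+ 2) <= i%:R * (w / 4).
  apply: (@le_trans _ _ (th / i%:R * (i%:R ^+ 2 * Q))).
    by rewrite ler_pM2l// /Q mulrDr lerD2l -exprMn.
  rewrite (_ : _ * (_ * Q) = i%:R * (th * Q)); last by field; rewrite gt_eqF.
  by rewrite ler_pM2l.
by move: ex; rewrite /A /t; lra.
Qed.

End uniform_drift.

(** * The Lyapunov exponent *)

Section projective_measurability.
Variables (R : realType) (n : nat).
Local Notation G := (GL R n.+1).
Local Notation X := (projspace R n).
Implicit Types (g h : G) (u : X).

Let nzcoord_continuous i : continuous (fun x : nzvec R n => nzvec_val x i 0).
Proof.
move=> x; apply: (@continuous_comp (nzvec R n) 'cV[R]_n.+1 R (@nzvec_val R n) (fun v => v i 0)).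
  exact: initial_continuous.
exact: coord_continuous.
Qed.

(** The entries of the orthogonal projection onto the line [u]. They are continuous on projective
    space, and |g x|^2 / |x|^2 is linear in them, so the cocycle is a measurable function of them
    and of the entries of [g]. *)
Definition projcoord i j u : R :=
  nzvec_val (repr u) i 0 * nzvec_val (repr u) j 0 / enorm (nzvec_val (repr u)) ^+ 2.

Let nzenorm_sqr_continuous : continuous (fun x : nzvec R n => enorm (nzvec_val x) ^+ 2).
Proof.
under [X in continuous X]eq_fun do rewrite sqr_enorm.
apply: continuous_big => [|k _]; first exact: add_continuous.
under [X in continuous X]eq_fun do rewrite expr2.
by move=> x; exact: (cvgM (@nzcoord_continuous k x) (@nzcoord_continuous k x)).
Qed.

Lemma projcoord_continuous i j : continuous (projcoord i j).
Proof.
apply: (@repr_comp_continuous (nzvec R n) X R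
  (fun x => nzvec_val x i 0 * nzvec_val x j 0 / enorm (nzvec_val x) ^+ 2)).
  move=> x; have x0 : enorm (nzvec_val x) ^+ 2 != 0.
    by rewrite expf_neq0// enorm_eq0 nzvec_neq0.
  exact: (cvgM (cvgM (@nzcoord_continuous i x) (@nzcoord_continuous j x))
    (cvgV x0 (@nzenorm_sqr_continuous x))).
move=> a b /eqP/eqquotP/asboolP[c c0 ->]; rewrite !mxE enormZ; apply/eqP.
rewrite exprMn real_normK ?num_real//.
by field; rewrite c0 enorm_eq0 nzvec_neq0.
Qed.

Lemma measurable_projcoord i j : measurable_fun setT (projcoord i j).
Proof.
apply: measurable_gtP => a; apply: sub_sigma_algebra.
have /continuousP/(_ [set x | a < x]) := @projcoord_continuous i j.
by apply; exact: open_gt.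
Qed.

Lemma sigma_cocycleE g u :
  sigma_cocycle g u = ln (Num.sqrt
    (\sum_i \sum_j \sum_l GLmx g i j * GLmx g i l * projcoord j l u)).
Proof.
rewrite /sigma_cocycle; set x := nzvec_val (repr u).
have x0 : x != 0 by exact: nzvec_neq0.
congr ln; have y0 : 0 <= enorm (GLmx g *m x) / enorm x by rewrite divr_ge0 ?enorm_ge0.
rewrite -[LHS](ger0_norm y0) -sqrtr_sqr; congr Num.sqrt.
rewrite exprMn exprVn sqr_enorm mulr_suml; apply: eq_bigr => i _.
rewrite mxE expr2 !mulr_suml; apply: eq_bigr => j _.
rewrite mulr_sumr mulr_suml; apply: eq_bigr => l _.
by rewrite /projcoord -/x; ring.
Qed.

Lemma measurable_sigma_cocycle d (T : measurableType d) (a : T -> G) (b : T -> X) :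
  measurable_fun setT a -> measurable_fun setT b ->
  measurable_fun setT (fun t => sigma_cocycle (a t) (b t)).
Proof.
move=> ma mb; under eq_fun do rewrite sigma_cocycleE.
apply: measurableT_comp; first exact: measurable_ln.
apply: (measurableT_comp (f := @Num.sqrt R)).
  by apply: continuous_measurable_fun; exact: sqrt_continuous.
apply: measurable_sum => i; apply: measurable_sum => j; apply: measurable_sum => l.
apply: measurable_funM; last exact: (measurableT_comp (measurable_projcoord j l) mb).
by apply: measurable_funM; apply: (measurableT_comp (measurable_GL_coord _ _) ma).
Qed.

End projective_measurability.

Section lyapunov_exponent.
Variables (R : realType) (n : nat).
Local Notation G := (GL R n.+1).
Local Notation X := (projspace R n).
Implicit Types (k : probability G R) (u : X).
Variables (c r : R).
Hypotheses (r01 : 0 < r < 1) (c0 : 0 < c).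

Definition projdrift k u : R := drift k (nzvec_val (repr u)).

Lemma driftZ k (a : R) (x : 'cV[R]_n.+1) : a != 0 -> drift k (a *: x) = drift k x.
Proof. by move=> a0; apply: eq_Rintegral => g _; exact: logratioZ. Qed.

Lemma projdrift_act k g u :
  projdrift k (proj_act g u) = drift k (GLmx g *m nzvec_val (repr u)).
Proof.
rewrite /projdrift /proj_act; have [a a0 ->] := repr_piP (nzvec_act g (repr u)).
exact: driftZ.
Qed.

Lemma projdrift_le k u : tame c r k -> `|projdrift k u| <= \int[k]_g lognorm g.
Proof. by move=> tk; apply: (drift_le r01 c0 tk); exact: nzvec_neq0. Qed.

Lemma measurable_cocycle_diff : measurable_fun setT (fun z : G * (G * X) =>
  sigma_cocycle (GLmul z.1 z.2.1) z.2.2 - sigma_cocycle z.2.1 z.2.2).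
Proof.
have m2 : measurable_fun setT (fun z : G * (G * X) => z.2.1).
  exact: (measurableT_comp measurable_fst measurable_snd).
have m3 : measurable_fun setT (fun z : G * (G * X) => z.2.2).
  exact: (measurableT_comp measurable_snd measurable_snd).
apply: measurable_funB; apply: measurable_sigma_cocycle => //.
exact: measurable_GLmul.
Qed.

(* The map (g, u) |-> proj_act g u is not known to be measurable; composed with
   projdrift, it becomes an integral of a difference of cocycles. *)
Lemma measurable_projdrift_act k (m : probability (G * X)%type R) : tame c r k ->
  measurable_fun setT (fun z : G * X => projdrift k (proj_act z.1 z.2)).
Proof.
move=> tk.
pose F (z : G * (G * X)) :=
  sigma_cocycle (GLmul z.1 z.2.1) z.2.2 - sigma_cocycle z.2.1 z.2.2.
have FE z : F z = logratio (GLmx z.1) (GLmx z.2.1 *m nzvec_val (repr z.2.2)).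
  by rewrite -[LHS]/(logratio _ _ - logratio _ _) logratioM ?nzvec_neq0// addrK.
have Fi : (k \x m)%E.-integrable setT (EFin \o F).
  apply: (dominated_integrable (g := fun z : G * (G * X) => lognorm z.1)) => //.
  - exact: measurable_cocycle_diff.
  - move=> z; rewrite FE; apply: logratio_le.
    by apply: GL_mulmx_neq0; exact: nzvec_neq0.
  - by apply: integrable_fst_prod; exact: (tame_lognorm r01 c0).
have [|di _] := Rintegral_prod _ Fi.
  move=> z; have x0 : GLmx z.1 *m nzvec_val (repr z.2) != 0.
    by apply: GL_mulmx_neq0; exact: nzvec_neq0.
  under [X in EFin \o X]eq_fun do rewrite FE /=.
  exact: (tame_logratio r01 c0 tk x0).
rewrite (_ : (fun z => _) = (fun z => \int[k]_h F (h, z))).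
  by apply/measurable_EFinP; exact: (measurable_int _ di).
apply/funext => z; rewrite projdrift_act.
by apply: eq_Rintegral => h _; rewrite FE.
Qed.

Lemma Rintegral_projdrift k (nu : probability X R) : tame c r k ->
  nu.-integrable setT (EFin \o projdrift k) /\
  \int[(k \x nu)%E]_z sigma_cocycle z.1 z.2 = \int[nu]_u projdrift k u.
Proof.
move=> tk; apply: Rintegral_prod => [u|].
  exact: (tame_logratio r01 c0 tk (nzvec_neq0 (repr u))).
apply: (dominated_integrable (g := fun z : G * X => lognorm z.1)) => //.
- exact: measurable_sigma_cocycle.
- by move=> z; apply: logratio_le; exact: nzvec_neq0.
- by apply: integrable_fst_prod; exact: (tame_lognorm r01 c0).
Qed.

Variables (mu : probability G R) (nu : probability X R).
Hypotheses (tmu : tame c r mu) (inv : invariant_measure mu nu).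

(** Peeling off the first factor, D_(m+1)(u) is D_1(u) plus the mean of D_m(g u), and invariance
    applies to the bounded function D_m. *)
Lemma Rintegral_projdrift_walk m :
  \int[nu]_u projdrift (walk mu m) u = m%:R * lyapunov mu nu.
Proof.
elim: m => [|m IH].
  rewrite mul0r -[RHS](Rintegral_cst_prob nu 0); apply: eq_Rintegral => u _.
  rewrite /projdrift /drift walk0 /Rintegral integral_dirac//; last first.
    by apply/measurable_EFinP; exact: measurable_logratio.
  by rewrite diracT mul1e logratio1// nzvec_neq0.
have tm := tame_walk r01 c0 m tmu.
have [di dE] := Rintegral_projdrift nu tm.
have [di1 dE1] := Rintegral_projdrift nu tmu.
have ma := measurable_projdrift_act (mu \x nu)%E tm.
have Fi : (mu \x nu)%E.-integrable setT
    (EFin \o (fun z : G * X => projdrift (walk mu m) (proj_act z.1 z.2))).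
  apply: (dominated_integrable ma) (integrable_cst_prob _ _) => z.
  exact: (projdrift_le (proj_act z.1 z.2) tm).
have F1 u : mu.-integrable setT
    (EFin \o (fun g => projdrift (walk mu m) (proj_act g u))).
  under [X in EFin \o X]eq_fun do rewrite projdrift_act.
  exact: (drift_conv r01 c0 tm tmu (nzvec_neq0 (repr u))).1.
have [Gi GE] := Rintegral_prod F1 Fi.
transitivity (\int[nu]_u (\int[mu]_g projdrift (walk mu m) (proj_act g u) +
    projdrift mu u)).
  apply: eq_Rintegral => u _.
  under [in RHS]eq_Rintegral do rewrite projdrift_act.
  rewrite -(drift_conv r01 c0 tm tmu (nzvec_neq0 (repr u))).2 /projdrift /drift /Rintegral.
  by congr fine; apply: eq_integral_measure => A mA; exact: walkSr.
rewrite RintegralD// -dE1 -/(lyapunov mu nu) mulrSr mulrDl mul1r; congr (_ + _).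
rewrite -IH -GE; apply/esym/inv; first by apply/measurable_EFinP; exact: (measurable_int _ di).
by eexists => u; exact: projdrift_le.
Qed.

Lemma drift_ge_lyapunov (b : R) (m : nat) :
  (forall x : 'cV[R]_n.+1, x != 0 -> m%:R * b <= drift (walk mu m) x) ->
  m%:R * b <= m%:R * lyapunov mu nu.
Proof.
move=> mb; rewrite -Rintegral_projdrift_walk -[leLHS](Rintegral_cst_prob nu).
apply: le_Rintegral => //; first exact: integrable_cst_prob.
- exact: (Rintegral_projdrift nu (tame_walk r01 c0 m tmu)).1.
- by move=> u _; apply: mb; exact: nzvec_neq0.
Qed.

Lemma drift_le_lyapunov (b : R) (m : nat) :
  (forall x : 'cV[R]_n.+1, x != 0 -> drift (walk mu m) x <= m%:R * b) ->
  m%:R * lyapunov mu nu <= m%:R * b.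
Proof.
move=> mb; rewrite -Rintegral_projdrift_walk -[leRHS](Rintegral_cst_prob nu).
apply: le_Rintegral => //; last by move=> u _; apply: mb; exact: nzvec_neq0.
- exact: (Rintegral_projdrift nu (tame_walk r01 c0 m tmu)).1.
- exact: integrable_cst_prob.
Qed.

End lyapunov_exponent.

(** * Random products *)

Section joint_law.
Context d d1 d2 (T : measurableType d) (T1 : measurableType d1) (T2 : measurableType d2).
Context (R : realType) (P : probability T R).

(** Uniqueness of product measures, for the law of the pair under [P] restricted to [E], whose total
    mass is [a]. *)
Lemma joint_law_restr (m1 : probability T1 R) (m2 : probability T2 R)
    (X1 : T -> T1) (X2 : T -> T2) (E : set T) (a : {nonneg R}) :
  measurable_fun setT X1 -> measurable_fun setT X2 -> measurable E ->
  (forall A B, measurable A -> measurable B ->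
    P ([set w | A (X1 w) /\ B (X2 w)] `&` E) = (a%:num%:E * m1 A * m2 B)%E) ->
  forall D, measurable D ->
    P ([set w | D (X1 w, X2 w)] `&` E) = (a%:num%:E * (m1 \x m2)%E D)%E.
Proof.
move=> mX1 mX2 mE rect D mD.
have mX : measurable_fun setT (fun w => (X1 w, X2 w)) by exact: measurable_fun_pair.
have := @product_measure_unique _ _ T1 T2 R (mscale a m1) m2
  (pushforward (mrestr P mE) (fun w => (X1 w, X2 w))).
move=> /(_ mX rect D mD) DE.
transitivity ((mscale a m1 \x m2)%E D); first exact/esym.
rewrite /product_measure1 ge0_integral_mscale//.
exact: measurable_fun_xsection.
Qed.

End joint_law.

Section random_walk_law.
Context (R : realType) (n : nat) d (T : measurableType d) (P : probability T R).
Local Notation G := (GL R n.+1).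
Variables (mu : probability G R) (Y : nat -> {RV P >-> G}).
Hypothesis iidY : iid_with_law mu Y.

Lemma measurable_rprod j : measurable_fun setT (rprod Y j).
Proof.
elim: j => [|j IH] /=; first exact: measurable_cst.
exact: measurable_GLmul.
Qed.

(** The event on factors of index at least [j] is there for the induction: [Y j] joins the list, and
    its independence from [rprod Y j] is read off the induction hypothesis. *)
Lemma rprod_law_joint j (s : seq nat) (A : set G) (B : nat -> set G) :
  uniq s -> all (leq j) s -> measurable A -> (forall i, measurable (B i)) ->
  P ([set w | A (rprod Y j w)] `&` \big[setI/setT]_(i <- s) (Y i @^-1` B i)) =
  (walk mu j A * \prod_(i <- s) mu (B i))%E.
Proof.
elim: j s A B => [|j IH] s A B us js mA mB.
  have PE : P (\big[setI/setT]_(i <- s) (Y i @^-1` B i)) = (\prod_(i <- s) mu (B i))%E.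
    by rewrite iidY.1//; apply: eq_bigr => i _; exact: iidY.2.
  rewrite walk0 /= diracE; have [A1|A1] := boolP (GL1 R n.+1 \in A).
    rewrite mul1e -PE; congr (P _); rewrite -[RHS]setTI; congr (_ `&` _).
    by apply/seteqP; split => w //= _; exact/set_mem.
  rewrite mul0e (_ : [set w | _] = set0) ?set0I ?measure0//.
  by apply/seteqP; split => w //= /mem_set; rewrite (negbTE A1).
set E := \big[setI/setT]_(i <- s) _.
have mE : measurable E.
  by apply: bigsetI_measurable => i _; rewrite -[X in measurable X]setTI; exact: measurable_funPT.
have p0 : (0 <= \prod_(i <- s) mu (B i))%E by apply: prode_ge0.
have pf : (\prod_(i <- s) mu (B i))%E \is a fin_num.
  by apply: prode_fin_num => i _; exact: fin_num_measure.
have [a aE] : exists a : {nonneg R}, (a%:num)%:E = (\prod_(i <- s) mu (B i))%E.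
  by exists (NngNum (fine_ge0 p0)); rewrite /= fineK.
have rect A1 A2 : measurable A1 -> measurable A2 ->
    P ([set w | A1 (Y j w) /\ A2 (rprod Y j w)] `&` E) = (a%:num%:E * mu A1 * walk mu j A2)%E.
  move=> mA1 mA2.
  pose B' i := if i == j then A1 else B i.
  have js' : j \notin s by apply/negP => /(allP js); rewrite ltnn.
  have := IH (j :: s) A2 B' _ _ mA2 _.
  rewrite /= js' us leqnn /= !big_cons /B' eqxx.
  rewrite (_ : all _ _); last by apply/allP => i /(allP js)/ltnW.
  move=> /(_ erefl erefl).
  have Bs i : i \in s -> (if i == j then A1 else B i) = B i.
    by move=> si; case: eqP => // ij; move: js'; rewrite -ij si.
  rewrite (eq_big_seq (fun i => Y i @^-1` B i)); last by move=> i /Bs ->.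
  rewrite (eq_big_seq (fun i => mu (B i))); last by move=> i /Bs ->.
  rewrite -/E -aE => IH'.
  rewrite muleC muleA muleAC -muleA -IH'; last by move=> i; case: ifP.
  congr (P _); rewrite setIA; congr (_ `&` _).
  by apply/seteqP; split => w /= [].
have mD : measurable [set z : G * G | A (GLmul z.1 z.2)].
  by have := measurable_GLmul_pair measurableT mA; rewrite setTI.
have := joint_law_restr (@measurable_funPT _ _ _ _ (Y j)) (measurable_rprod j) mE rect mD.
by rewrite aE muleC.
Qed.

Lemma rprod_law j (A : set G) : measurable A ->
  P [set w | A (rprod Y j w)] = walk mu j A.
Proof.
move=> mA; have := @rprod_law_joint j [::] A (fun=> setT) erefl erefl mA (fun=> measurableT).
by rewrite !big_nil setIT mule1.
Qed.

End random_walk_law.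

Section limit_superior.
Variable R : realType.
Local Open Scope ereal_scope.

Lemma limn_esup_le_near (u : (\bar R)^nat) (a : \bar R) (N0 : nat) :
  (forall n, (N0 <= n)%N -> u n <= a) -> limn_esup u <= a.
Proof.
move=> ua; apply: (@le_trans _ _ (ereal_sup (u @` [set n | (N0 <= n)%N]))).
  by apply: ereal_inf_lbound; exists [set n | (N0 <= n)%N] => //; exists N0.
by apply: ge_ereal_sup => _ [n /= /ua un <-].
Qed.

Lemma lne_le_expR (z : \bar R) (a : R) : 0 <= z -> z <= (expR a)%:E -> lne z <= a%:E.
Proof.
by move=> z0 za; rewrite -[leRHS]expeRK lee_lne// in_itv/= leey andbT//.
Qed.

End limit_superior.

(** * Union bound for the maximal deviation *)

Section max_deviation.
Context (R : realType) (n : nat) d (T : measurableType d) (P : probability T R).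
Local Notation G := (GL R n.+1).
Variables (mu : probability G R) (Y : nat -> {RV P >-> G}).
Hypothesis iidY : iid_with_law mu Y.
Implicit Type x : 'cV[R]_n.+1.

Lemma measurable_max_deviation lambda x j :
  measurable_fun setT (max_deviation Y lambda x j).
Proof.
rewrite /max_deviation; elim: (index_iota _ _) => [|k s IH].
  by under eq_fun do rewrite big_nil; exact: measurable_cst.
under eq_fun do rewrite big_cons.
apply: measurable_maxr => //; apply: measurableT_comp => //.
apply: measurable_funB => //.
apply: (measurableT_comp (f := fun g : G => ln (enorm (g *m x))) (g := rprod Y k)).
  by apply: measurableT_comp; [exact: measurable_ln|exact: measurable_GL_enorm].
exact: measurable_rprod.
Qed.

(** The default value 0 of the maximum cannot exceed the level because [0 <= a]. The times from 1 to
    [j] are written [k.+1]. *)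
Lemma max_deviation_gt lambda x j a w : 0 <= a -> a < max_deviation Y lambda x j w ->
  exists2 k : nat, (k < j)%N &
    a < `|ln (enorm (rprod Y k.+1 w *m x)) - k.+1%:R * lambda|.
Proof.
move=> a0; apply: contraPP => nk; apply/negP; rewrite -leNgt /max_deviation.
rewrite big_nat_cond; apply: bigmax_le => // -[//|k] /andP[/andP[_ kj] _].
by rewrite leNgt; apply/negP => ak; apply: nk; exists k.
Qed.

(** At each time the absolute value splits into the cases [eta = 1] and [eta = -1], whence
    [2 * q]. *)
Lemma deviation_union_bound (lambda q t : R) x N : usphere x -> 0 <= t ->
  (forall (eta : R) j, `|eta| = 1 :> R -> (j <= N)%N ->
    (walk mu j [set g : G | (t + j%:R * (eta * lambda) < eta * logratio g x)%R] <=
      q%:E)%E) ->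
  (P [set w | (t < max_deviation Y lambda x N w)%R] <= (N%:R * (2 * q))%:E)%E.
Proof.
move=> x1 t0 dev.
have x0 : x != 0 by rewrite -enorm_gt0 (x1 : enorm x = 1).
pose E (eta : R) k :=
  [set w | (t + k.+1%:R * (eta * lambda) < eta * logratio (rprod Y k.+1 w) x)%R].
have mE eta k : measurable (E eta k).
  pose F := [set g : G | (t + k.+1%:R * (eta * lambda) < eta * logratio g x)%R].
  have mF : measurable F by exact: measurable_logratio_gt.
  by have := measurable_rprod Y k.+1 measurableT mF; rewrite setTI.
have PE eta k : `|eta| = 1 :> R -> (k < N)%N -> (P (E eta k) <= q%:E)%E.
  move=> e1 kN; have := dev eta k.+1 e1 kN; apply: le_trans.
  by rewrite -(rprod_law iidY)//; exact: measurable_logratio_gt.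
have mU : measurable [set w | t < max_deviation Y lambda x N w].
  have := @measurable_max_deviation lambda x N measurableT `]t, +oo[%classic.
  rewrite setTI (_ : _ @^-1` _ = [set w | t < max_deviation Y lambda x N w]).
    by apply; exact: measurable_itv.
  by apply/seteqP; split => w /=; rewrite in_itv/= andbT.
apply: (@le_trans _ _ (\sum_(k < N) P (E 1%R k `|` E (-1)%R k))%E).
  apply: (@content_subadditive _ _ _ P _ (fun k => E 1 k `|` E (-1) k)) => //.
    by move=> k _; exact: measurableU.
  move=> w /= /(max_deviation_gt t0)[k kN].
  rewrite -(bigcup_mkord N (fun k => E 1 k `|` E (-1) k)) => tk; exists k => //=; move: tk.
  have -> : ln (enorm (rprod Y k.+1 w *m x)) = logratio (rprod Y k.+1 w) x.
    by rewrite /logratio (x1 : enorm x = 1) divr1.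
  rewrite lter_normr => /orP[tk|tk]; [left|right].
    by rewrite /E /= !mul1r; lra.
  by rewrite /E /= !mulN1r; lra.
apply: (@le_trans _ _ (\sum_(k < N) (2 * q)%:E)%E).
  apply: lee_sum => k _; apply: (le_trans (measureU2 _ _ _)) => //.
  rewrite mulr_natl mulr2n EFinD; apply: leeD; apply: PE => //.
    by rewrite normr1.
  by rewrite normrN1.
by rewrite sumEFin sumr_const card_ord lee_fin -[leLHS]mulr_natl.
Qed.

End max_deviation.

Theorem theorem2p2 (R : realType) (d : nat)
    (mu : probability (GL R d.+2) R) (nu : probability (projspace R d.+1) R)
    (disp : measure_display) (T : measurableType disp) (P : probability T R)
    (Y : nat -> {RV P >-> GL R d.+2}) (r delta : R) :
  strongly_irreducible mu -> proximal mu ->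
  invariant_measure mu nu ->
  iid_with_law mu Y ->
  0 < r < 1 -> 0 < delta ->
  (\int[mu]_g (expR (delta * ln (GL_N g) `^ r))%:E < +oo)%E ->
  exists C : R, 0 < C /\
    forall y : R, 0 < y ->
      (limn_esup (fun n : nat =>
         ((n%:R `^ r)^-1)%:E *
         lne (ereal_sup
           [set P [set w | (n%:R * y < max_deviation Y (lyapunov mu nu) x n w)%R]
           | x in @usphere R d.+2]))
       <= (- (C * y `^ r))%:E)%E.
Proof.
move=> SI _ inv iidY r01 d0 tmu; have /andP[r0 _] := r01.
have {}tmu : tame delta r mu by exact: tmu.
(* [walk_deviation] gives the rate [delta / 3]; absorbing the factor 2 N of the union bound divides
   it by 3 again. *)
exists (delta / 9); split=> [|y y0]; first by rewrite divr_gt0.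
pose M := \int[mu]_g (lognorm g ^+ 2).
have M0 : 0 <= M by apply: Rintegral_ge0 => g _; exact: sqr_ge0.
have muM : (\int[mu]_g (lognorm g ^+ 2)%:E <= M%:E)%E.
  by rewrite Rintegral_EFin//; exact: (tame_sqr r01 d0 tmu).
pose beta := bottom_drift mu; pose lambda := lyapunov mu nu.
have beta_le : beta <= lambda.
  apply: ge_sup => [|b [m m0 mb]]; first exact: (lower_drift_has_sup r01 d0 tmu M0 muM).1.
  have := drift_ge_lyapunov r01 d0 tmu inv mb.
  by rewrite ler_pM2l// ltr0n.
have le_beta : lambda <= beta.
  apply/ler_addgt0Pr => w w0.
  have [m m0 mb] := uniform_drift_upper r01 d0 tmu M0 muM SI w0.
  have := drift_le_lyapunov r01 d0 tmu inv mb.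
  by rewrite ler_pM2l// ltr0n.
have y40 : 0 < y / 4 by rewrite divr_gt0.
(* The block lengths [m1] and [m2] depend on [y] through the tolerance [y / 4]; the rate does
   not. *)
have [m1 m10 m1P] := uniform_drift_upper r01 d0 tmu M0 muM SI y40.
have [b [m2 m20 m2P] bb] : exists2 b, lower_drift mu b & beta - y / 4 < b.
  by apply: sup_adherent => //; exact: (lower_drift_has_sup r01 d0 tmu M0 muM).
have [N1 N1P] : exists N0, forall N j, (N0 <= N)%N -> (j <= N)%N ->
    forall x : 'cV[R]_d.+2, x != 0 ->
    (walk mu j [set g : GL R d.+2 | (N%:R * y + j%:R * lambda < 1 * logratio g x)%R] <=
     (expR (- (delta / 3 * (N%:R * y) `^ r)))%:E)%E.
  apply: (walk_deviation r01 d0 tmu m10) => //; first by rewrite normr1.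
  move=> x /m1P; rewrite mul1r => /le_trans; apply.
  by rewrite ler_pM2l ?ltr0n// lerD2r.
have [N2 N2P] : exists N0, forall N j, (N0 <= N)%N -> (j <= N)%N ->
    forall x : 'cV[R]_d.+2, x != 0 ->
    (walk mu j [set g : GL R d.+2 | (N%:R * y + j%:R * - lambda < -1 * logratio g x)%R] <=
     (expR (- (delta / 3 * (N%:R * y) `^ r)))%:E)%E.
  apply: (walk_deviation r01 d0 tmu m20) => //; first by rewrite normrN1.
  move=> x /m2P mb; have : m2%:R * (lambda - y / 4) <= m2%:R * b.
    by rewrite ler_pM2l ?ltr0n//; lra.
  by lra.
have d30 : 0 < delta / 3 by rewrite divr_gt0.
(* With A = 2 and K = 0, the first summand alone dominates 2 N exp(- (delta / 3) (N y)^r). *)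
have [N3 N3P] := stretched_exp_asymptotics d30 r01 y0 (ler0n R 2) (lexx 0).
apply: (@limn_esup_le_near _ _ _ (maxn (maxn N1 N2) (maxn N3 1))) => N.
rewrite !geq_max => /andP[/andP[N1N N2N] /andP[N3N N0]].
have NR0 : 0 < N%:R :> R by rewrite ltr0n.
have Nr0 : 0 < N%:R `^ r :> R by rewrite powR_gt0.
have -> : (- (delta / 9 * y `^ r))%:E =
    (((N%:R `^ r)^-1)%:E * (- (delta / 9 * (N%:R * y) `^ r))%:E)%E :> \bar R.
  rewrite -EFinM powRM ?(ltW y0)//; congr EFin; field; by rewrite gt_eqF.
rewrite lee_pmul2l ?fin_numE// ?lte_fin ?invr_gt0//.
apply: lne_le_expR.
  have [x x1] := @usphere_nonempty R d.+1.
  apply: (@le_trans _ _ (P [set w | (N%:R * y < max_deviation Y lambda x N w)%R])).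
    exact: measure_ge0.
  by apply: ereal_sup_ubound; exists x.
apply: ge_ereal_sup => _ [x x1 <-].
have x0 : x != 0 by rewrite -enorm_gt0 (x1 : enorm x = 1).
pose q := expR (- (delta / 3 * (N%:R * y) `^ r)).
apply: (@le_trans _ _ (N%:R * (2 * q))%:E).
  apply: (deviation_union_bound iidY x1); first by rewrite mulr_ge0// ltW.
  move=> eta j /eqP; rewrite eqr_norml => /andP[/orP[]/eqP-> _] jN.
    by rewrite mul1r; exact: N1P.
  by rewrite mulN1r; exact: N2P.
rewrite lee_fin; have [_ _] := N3P N N3N.
rewrite (_ : delta / 3 / 3 = delta / 9); last by field.
apply: le_trans; rewrite mulrA -/q ler_wpDr//.
by rewrite !ler_wpM2r ?expR_ge0// ler_nat.
Qed.
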